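(* Let $M$ be a smooth manifold of dimension $n\geq 2$ and let $F$ and $\widetilde{F}$ be two projectively related Finsler metrics on $M$. Let $S$ be the geodesic spray of $F$, and let $f_\alpha$ be the coefficients of the characteristic polynomial $$Q(\Lambda)=\det\left(\mathcal{H}^i_j+\Lambda\delta^i_j\right)=\sum_{\alpha=1}^n f_\alpha\Lambda^\alpha,\qquad \mathcal{H}^i_j=\frac{F}{\widetilde{F}}\,g^{ik}\,\widetilde{h}_{kj}.$$ Then for every $\alpha\in\{1,\dots,n-1\}$ the function $f_\alpha$ is a first integral of the geodesic spray $S$ of the Finsler metric $F$, that is, $S(f_\alpha)=0$ on $T_0M$.
   Context: $TM$ is the tangent bundle of $M$ and $T_0M=TM\setminus\{0\}$ is the tangent bundle with the zero section removed; $(x^i,y^i)$ are the coordinates on $TM$ induced by local coordinates $(x^i)$ on $M$. The summation convention is used. A Finsler metric (Finsler structure) on $M$ is a continuous function $F:TM\to[0,+\infty)$, smooth on $T_0M$, such that (1) $F(x,\lambda y)=\lambda F(x,y)$ for all $\lambda>0$ and $(x,y)\in T_0M$; (2) the metric tensor $g_{ij}=\frac12\frac{\partial^2F^2}{\partial y^i\partial y^j}$ is non-degenerate on $T_0M$. Its inverse is denoted $g^{ij}$. The angular metric of $F$ is $h_{ij}=F\frac{\partial^2F}{\partial y^i\partial y^j}=g_{ij}-\frac{\partial F}{\partial y^i}\frac{\partial F}{\partial y^j}$. For $\widetilde{F}$ the corresponding objects are written $\widetilde{g}_{ij}$ and $\widetilde{h}_{ij}=\widetilde{F}\frac{\partial^2\widetilde{F}}{\partial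 y^i\partial y^j}$. The geodesic spray of $F$ is the unique vector field $S$ on $T_0M$, of the local form $S=y^i\frac{\partial}{\partial x^i}-2G^i(x,y)\frac{\partial}{\partial y^i}$, that satisfies the Euler-Lagrange equations $\mathcal{L}_Sd_JF^2-dF^2=0$, where $d_JF^2=\frac{\partial F^2}{\partial y^i}dx^i$ (in coordinates, $S\left(\frac{\partial F^2}{\partial y^i}\right)=\frac{\partial F^2}{\partial x^i}$). The geodesics of $F$ are the projections to $M$ of the integral curves of $S$. Two Finsler metrics $F$ and $\widetilde{F}$ on $M$ are projectively related (geodesically equivalent) if their geodesics coincide as unparameterised oriented curves. The polynomial $Q$ has no free term, since $\widetilde{h}_{ij}y^j=0$ gives $\det(\mathcal{H}^i_j)=0$; its coefficients $f_\alpha$ are globally defined functions on $T_0M$. *)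

(* Defs.v *)
From mathcomp Require Import all_boot all_order all_algebra.
From mathcomp Require Import all_classical all_reals all_analysis.
Set Implicit Arguments.
Unset Strict Implicit.
Unset Printing Implicit Defensive.
Import Order.TTheory GRing.Theory Num.Theory.
Import numFieldNormedType.Exports.
Local Open Scope classical_set_scope.
Local Open Scope ring_scope.

Section SmoothMaps.
Variables (R : realType) (V W : normedModType R).

Fixpoint Ck (k : nat) (U : set V) (f : V -> W) : Prop :=
  if k is k'.+1 then
    (forall x, U x -> differentiable f x) /\ (forall v, Ck k' U ('D_v f))
  else forall x, U x -> {for x, continuous f}.

(* Meant for [U] open. *)
Definition smooth_on (U : set V) (f : V -> W) : Prop := forall k, Ck k U f.

End SmoothMaps.

(* The atlas is an arbitrary smooth atlas; it need not be maximal. The maps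
   [mphi i] and [mpsi i] are total, with unspecified values outside the chart
   domain [mdom i] and its image respectively. *)
Record smooth_manifold (R : realType) (n : nat) := SmoothManifold {
  mcarrier :> topologicalType;
  mhausdorff : hausdorff_space mcarrier;
  msecond_countable : @second_countable mcarrier;
  mindex : Type;
  mdom : mindex -> set mcarrier;
  mphi : mindex -> mcarrier -> 'rV[R]_n;
  mpsi : mindex -> 'rV[R]_n -> mcarrier;
  mdom_open : forall i, open (mdom i);
  mdom_cover : forall p, exists i, mdom i p;
  mrange_open : forall i, open (mphi i @` mdom i);
  mphiK : forall i p, mdom i p -> mpsi i (mphi i p) = p;
  mphi_continuous : forall i p, mdom i p -> {for p, continuous (mphi i)};
  mpsi_continuous : forall i x, (mphi i @` mdom i) x ->
    {for x, continuous (mpsi i)};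
  mtrans_smooth : forall i j,
    smooth_on [set x | (mphi i @` mdom i) x /\ mdom j (mpsi i x)]
              (mphi j \o mpsi i) }.

Section TangentBundle.
Variables (R : realType) (n : nat) (M : smooth_manifold R n).
Local Notation I := (mindex M).
Local Notation E := ('rV[R]_n * 'rV[R]_n)%type.

Definition mrange (i : I) : set 'rV[R]_n := mphi i @` mdom i.

Definition mtrans (i j : I) : 'rV[R]_n -> 'rV[R]_n := mphi j \o mpsi i.

(* A tangent vector is given by its components in all the charts at its base
   point, related by the Jacobians of the changes of coordinates; components
   in the other charts are set to 0 so that Leibniz equality is the right
   one. *)
Record tangent_bundle := TangentVector {
  tpt : M;
  tcomp : I -> 'rV[R]_n;
  tcomp_trans : forall i j, mdom i tpt -> mdom j tpt ->
    tcomp j = 'D_(tcomp i) (mtrans i j) (mphi i tpt);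
  tcomp_out : forall i, ~ mdom i tpt -> tcomp i = 0 }.

Definition slit_tangent_bundle : set tangent_bundle :=
  [set v | exists i, tcomp v i != 0].

(* The induced coordinates (x, y). *)
Definition tcoord (i : I) (v : tangent_bundle) : E :=
  (mphi i (tpt v), tcomp v i).

Lemma mpsi_dom i x : mrange i x -> mdom i (mpsi i x).
Proof. by move=> [p ip <-]; rewrite mphiK. Qed.

Lemma mpsiK i x : mrange i x -> mphi i (mpsi i x) = x.
Proof. by move=> [p ip <-]; rewrite mphiK. Qed.

Lemma near_overlap i j x : mrange i x -> mdom j (mpsi i x) ->
  \forall x' \near x, mrange i x' /\ mdom j (mpsi i x').
Proof.
move=> ix jx; apply: filterI.
  by apply: open_nbhs_nbhs; split=> //; exact: mrange_open.
have /(_ (mdom j)) := mpsi_continuous ix; apply.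
by apply: open_nbhs_nbhs; split=> //; exact: mdom_open.
Qed.

Lemma mtrans_diff i j x : mrange i x -> mdom j (mpsi i x) ->
  differentiable (mtrans i j) x.
Proof. by move=> ix jx; have [+ _] := @mtrans_smooth _ _ M i j 1; apply. Qed.

Lemma mtrans_id i x y : mrange i x -> 'D_y (mtrans i i) x = y.
Proof.
move=> ix; rewrite -[RHS](derive_id x y).
have [->|y0] := eqVneq y 0; first by rewrite !derive0.
apply: near_eq_derive => //.
have := near_overlap ix (mpsi_dom ix); apply: filterS => x' [ix' _].
by rewrite /mtrans /= mpsiK.
Qed.

Lemma mtrans_cocycle i j k x y :
  mrange i x -> mdom j (mpsi i x) -> mdom k (mpsi i x) ->
  'D_y (mtrans i k) x =
  'D_('D_y (mtrans i j) x) (mtrans j k) (mtrans i j x).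
Proof.
move=> ix jx kx.
have [->|y0] := eqVneq y 0; first by rewrite !derive0.
have jr : mrange j (mtrans i j x) by exists (mpsi i x).
have kjx : mdom k (mpsi j (mtrans i j x)) by rewrite /mtrans /= mphiK.
have dij := mtrans_diff ix jx.
have djk := mtrans_diff jr kjx.
transitivity ('D_y (mtrans j k \o mtrans i j) x).
  apply: near_eq_derive => //.
  have := near_overlap ix jx; apply: filterS => x' [ix' jx'].
  by rewrite /mtrans /= mphiK.
have dc : differentiable (mtrans j k \o mtrans i j) x.
  exact: differentiable_comp.
have ec := deriveE y dc; have eij := deriveE y dij.
have ejk := deriveE ('D_y (mtrans i j) x) djk.
have dd := diff_comp dij djk.
apply: (etrans ec); apply: (etrans _ (esym ejk)); rewrite eij.
exact: (f_equal (fun h => h y) dd).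
Qed.

Definition tvec_comp (i : I) (z : E) (j : I) : 'rV[R]_n :=
  if `[< mdom j (mpsi i z.1) >] then 'D_(z.2) (mtrans i j) z.1 else 0.

Lemma tvec_comp_trans i z (hz : mrange i z.1) j k :
  mdom j (mpsi i z.1) -> mdom k (mpsi i z.1) ->
  tvec_comp i z k =
  'D_(tvec_comp i z j) (mtrans j k) (mphi j (mpsi i z.1)).
Proof.
move=> jz kz; rewrite /tvec_comp (asboolT jz) (asboolT kz).
exact: mtrans_cocycle.
Qed.

Lemma tvec_comp_out i z j : ~ mdom j (mpsi i z.1) -> tvec_comp i z j = 0.
Proof. by move=> jz; rewrite /tvec_comp asboolF. Qed.

(* The tangent vector with coordinates z in the chart i. *)
Definition tvec (i : I) (z : E) (hz : mrange i z.1) : tangent_bundle :=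
  TangentVector (tvec_comp_trans hz) (@tvec_comp_out i z).

Lemma tvecK i z (hz : mrange i z.1) : tcoord i (tvec hz) = z.
Proof.
rewrite /tcoord /= mpsiK// /tvec_comp (asboolT (mpsi_dom hz)) mtrans_id//.
by case: z hz.
Qed.

Lemma tcoordK i v (hv : mrange i (tcoord i v).1) :
  mdom i (tpt v) -> tvec hv = v.
Proof.
case: v hv => p c ct co /= hv ip; rewrite /tvec /=.
have pE : mpsi i (mphi i p) = p by rewrite mphiK.
have cE : tvec_comp i (mphi i p, c i) = c.
  apply/funext => j; rewrite /tvec_comp /= pE.
  case: asboolP => jp; last by rewrite co.
  by rewrite -ct.
move: (tvec_comp_trans _) (@tvec_comp_out _ _).
rewrite /tcoord /= cE pE => a b.
by congr TangentVector; exact: Prop_irrelevance.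
Qed.

(* Expression of a function on TM in the induced coordinates of a chart,
   extended by 0. *)
Definition local_expr (f : tangent_bundle -> R) (i : I) (z : E) : R :=
  if pselect (mrange i z.1) is left hz then f (tvec hz) else 0.

(* Coordinate image of the slit tangent bundle over the chart i. *)
Definition slit_range (i : I) : set E := [set z | mrange i z.1 /\ z.2 != 0].

(* Change of the induced coordinates. *)
Definition ttrans (i j : I) (z : E) : E :=
  (mtrans i j z.1, 'D_(z.2) (mtrans i j) z.1).

(* A vector field on the slit tangent bundle, given by its components with
   respect to (d/dx, d/dy) in every chart. *)
Record slit_vector_field := SlitVectorField {
  svf :> I -> E -> E;
  svf_smooth : forall i, smooth_on (slit_range i) (svf i);
  svf_trans : forall i j z, slit_range i z -> mdom j (mpsi i z.1) ->
    svf j (ttrans i j z) = 'D_(svf i z) (ttrans i j) z }.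

(* [tpt \o gamma] is required to be continuous since the chart maps are
   unspecified outside their domains. *)
Definition integral_curve (S : slit_vector_field) (J : set R)
    (gamma : R -> tangent_bundle) : Prop :=
  forall t, J t ->
    [/\ slit_tangent_bundle (gamma t),
        {for t, continuous (tpt \o gamma)} &
        forall i, mdom i (tpt (gamma t)) ->
          is_derive t 1 (tcoord i \o gamma) (S i (tcoord i (gamma t)))].

(* The directions of d/dx^k and d/dy^k. *)
Definition xdir (k : 'I_n) : E := (delta_mx 0 k, 0).
Definition ydir (k : 'I_n) : E := (0, delta_mx 0 k).

Section Finsler.
Variable F : tangent_bundle -> R.

Definition sqF (i : I) (z : E) : R := local_expr F i z ^+ 2.

Definition metric_tensor (i : I) (z : E) : 'M[R]_n :=
  \matrix_(k, l) (2^-1 * 'D_(ydir k) ('D_(ydir l) (sqF i)) z).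

Definition angular_metric (i : I) (z : E) : 'M[R]_n :=
  \matrix_(k, l)
    (local_expr F i z * 'D_(ydir k) ('D_(ydir l) (local_expr F i)) z).

Record finsler_metric : Prop := FinslerMetric {
  finsler_ge0 : forall v, 0 <= F v;
  finsler_continuous : forall i z, mrange i z.1 ->
    {for z, continuous (local_expr F i)};
  finsler_smooth : forall i, smooth_on (slit_range i) (local_expr F i);
  finsler_homogeneous : forall i z (l : R), slit_range i z -> 0 < l ->
    local_expr F i (z.1, l *: z.2) = l * local_expr F i z;
  finsler_nondegenerate : forall i z, slit_range i z ->
    metric_tensor i z \in unitmx }.

(* The second condition is the Euler-Lagrange equation
   S(dF^2/dy^k) = dF^2/dx^k. *)
Definition geodesic_spray (S : slit_vector_field) : Prop :=
  forall i z, slit_range i z ->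
    (S i z).1 = z.2 /\
    (forall k, 'D_(S i z) ('D_(ydir k) (sqF i)) z = 'D_(xdir k) (sqF i) z).

Definition geodesic (J : set R) (c : R -> M) : Prop :=
  [/\ open J, is_interval J, J !=set0 &
      exists S gamma, [/\ geodesic_spray S, integral_curve S J gamma &
        forall t, J t -> c t = tpt (gamma t)]].

End Finsler.

Definition same_oriented_curve (J : set R) (c : R -> M)
    (J' : set R) (c' : R -> M) : Prop :=
  exists tau : R -> R,
    [/\ smooth_on J' tau, forall t, J' t -> 0 < 'D_1 tau t, tau @` J' = J &
        forall t, J' t -> c' t = c (tau t)].

Definition projectively_related (F Ft : tangent_bundle -> R) : Prop :=
  (forall J c, geodesic F J c ->
     exists J' c', geodesic Ft J' c' /\ same_oriented_curve J c J' c') /\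
  (forall J' c', geodesic Ft J' c' ->
     exists J c, geodesic F J c /\ same_oriented_curve J' c' J c).

Section CharacteristicPolynomial.
Variables F Ft : tangent_bundle -> R.

Definition calH (i : I) (z : E) : 'M[R]_n :=
  (local_expr F i z / local_expr Ft i z) *:
    (invmx (metric_tensor F i z) *m angular_metric Ft i z).

Definition calQ (i : I) (z : E) : {poly R} :=
  \det (map_mx polyC (calH i z) + 'X%:M).

Definition calf (alpha : nat) (i : I) (z : E) : R := (calQ i z)`_alpha.

End CharacteristicPolynomial.

(* The function is given by its expressions [f i] in the induced coordinates;
   S(f) is the derivative of f along S, whose existence is part of the
   requirement. *)
Definition first_integral (S : slit_vector_field) (f : I -> E -> R) : Prop :=
  forall i z, slit_range i z -> is_derive z (S i z) (f i) 0.

End TangentBundle.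

(* Main.v *)
(* Let S and St be the geodesic sprays of F and Ft. Running an F-geodesic through
   a given (x, y), which exists by Picard-Lindelof, and reparametrising it as a
   geodesic of Ft shows that, at a rescaled point (x, l y), St is the rescaled S
   plus a multiple of the Liouville field. Since Ft is homogeneous, the
   Euler-Lagrange equation of Ft then holds along S itself:
   S(dFt/dy^k) = dFt/dx^k. Differentiating this equation along the fibre and
   symmetrising kills the mixed derivatives and leaves, for the Hessian
   B = F (d^2 Ft / dy dy), the identity S(B) = N^T B + B N where N depends on S
   only (S(F) = 0 takes care of the factor F). The metric tensor g of F satisfies
   the same identity for the same reason. Hence det (B + X g) and det g both
   satisfy S(d) = 2 tr(N) d, and their quotient is Q. *)

(* The Liouville term is harmless because the fibre derivatives of a 1-homogeneous function are
   0-homogeneous, hence constant along the Liouville field C. The equation must therefore be used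
   for Ft and not for Ft^2, whose fibre derivatives are 1-homogeneous. But a geodesic spray is
   defined through squares, and passing from F^2 to F requires S(F) = 0 and F nonzero. The first
   comes from degree two: derived along S, Euler's identity C(F^2) = 2 F^2 becomes S(F^2) = 2 S(F^2)
   by the Euler-Lagrange equation; in degree one the same computation is empty. The second has to be
   extracted from nondegeneracy, as a metric is only assumed nonnegative.

   A geodesic comes with a spray of its own, so the spray of Ft obtained at a point may change with
   the point. For this reason [euler_lagrange s f z] speaks of a single vector [s] at a single point
   [z]. It becomes an identity between functions, which can be differentiated along the fibre, only
   once [s] is the value of the fixed field S. *)
From HB Require Import structures.
Require Import Defs.
From mathcomp Require Import all_boot all_order all_algebra.
From mathcomp Require Import all_classical all_reals all_analysis.
From mathcomp Require Import perm ring lra.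
Set Implicit Arguments.
Unset Strict Implicit.
Unset Printing Implicit Defensive.
Import Order.TTheory GRing.Theory Num.Theory.
Import numFieldNormedType.Exports.
Local Open Scope classical_set_scope.
Local Open Scope ring_scope.

(** * Symmetry of second derivatives *)

Section Lines.
Context {R : realType} {V : normedModType R}.

Lemma is_derive_line {W : normedModType R} (f : V -> W) p u s df :
  is_derive (p + s *: u) u f df ->
  is_derive s 1 (fun s => f (p + s *: u)) df.
Proof.
have E : (fun h : R => h^-1 *: (((fun s => f (p + s *: u)) \o shift s) (h *: 1)
                    - f (p + s *: u)))
       = (fun h => h^-1 *: ((f \o shift (p + s *: u)) (h *: u) - f (p + s *: u))).
  apply/funext => h /=; congr (_ *: (f _ - _)).
  by rewrite [h *: 1]mulr1 scalerDl addrCA.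
by case=> dv dd; apply: DeriveDef; rewrite /derivable /derive E.
Qed.

Lemma is_derive_translate {W : normedModType R} (f : V -> W) p w u df :
  is_derive (p + w) u f df -> is_derive p u (fun x => f (x + w)) df.
Proof.
have E : (fun h : R => h^-1 *: (((fun x => f (x + w)) \o shift p) (h *: u)
                    - f (p + w)))
       = (fun h => h^-1 *: ((f \o shift (p + w)) (h *: u) - f (p + w))).
  by apply/funext => h /=; rewrite addrA.
by case=> dv dd; apply: DeriveDef; rewrite /derivable /derive E.
Qed.

Lemma MVT_line (f : V -> R) p u (t : R) : 0 < t ->
  (forall s, s \in `[0, t] -> derivable f (p + s *: u) u) ->
  exists2 c, c \in `]0, t[ & f (p + t *: u) - f p = t * 'D_u f (p + c *: u).
Proof.
move=> t0 df.
have dl s : s \in `[0, t] -> is_derive s 1 (fun s => f (p + s *: u))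
    ('D_u f (p + s *: u)).
  by move=> st; apply: is_derive_line; apply: derivableP; exact: df.
have [c ct E] := @MVT _ (fun s => f (p + s *: u))
  (fun s => 'D_u f (p + s *: u)) 0 t t0
  (fun s sI => dl s (subset_itv_oo_cc sI))
  (derivable_within_continuous (fun s sI => @ex_derive _ _ _ _ _ _ _ (dl s sI))).
by exists c => //; move: E; rewrite scale0r addr0 subr0 mulrC.
Qed.

Lemma line_in_ball (z : V) (r : R) u v (a b t : R) :
  0 < t -> t * (`|u| + `|v|) < r -> a \in `[0, t] -> b \in `[0, t] ->
  ball z r (z + a *: u + b *: v).
Proof.
move=> t0 tr /itvP a_ /itvP b_; rewrite -ball_normE /= -addrA opprD addNKr normrN.
apply: le_lt_trans tr; apply: le_trans (ler_normD _ _) _.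
rewrite mulrDr !normrZ !ger0_norm ?a_ ?b_//.
by apply: lerD; apply: ler_wpM2r; rewrite ?a_ ?b_.
Qed.

(* Both mixed derivatives are limits of the second difference quotient
   [f (z + t u + t v) - f (z + t u) - f (z + t v) + f z] over [t^2]. *)
Lemma second_difference (f : V -> R) z u v (r t : R) : 0 < t ->
  t * (`|u| + `|v|) < r ->
  (forall x, ball z r x -> derivable f x u /\ derivable ('D_u f) x v) ->
  exists2 p, ball z r p &
    f (z + t *: u + t *: v) - f (z + t *: u) - f (z + t *: v) + f z =
    t * t * 'D_v ('D_u f) p.
Proof.
move=> t0 tr df.
have t_t : t \in `[0, t] by rewrite in_itv /= lexx ltW.
have o_t : 0 \in `[0, t] by rewrite in_itv /= lexx ltW.
pose phi x := f (x + t *: v) - f x.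
have dphi s : s \in `[0, t] -> is_derive (z + s *: u) u phi
    ('D_u f (z + s *: u + t *: v) - 'D_u f (z + s *: u)).
  move=> st; apply: is_deriveB.
    have B : ball z r (z + s *: u + t *: v) by exact: (line_in_ball _ t0 tr st t_t).
    have [dv _] := df _ B.
    exact/is_derive_translate/derivableP.
  apply: derivableP; have B := @line_in_ball z r u v s 0 t t0 tr st o_t.
  have {}B : ball z r (z + s *: u).
    by have -> : z + s *: u = z + s *: u + 0 *: v by rewrite scale0r addr0.
  by case: (df _ B).
have [c ct E] := @MVT_line phi z u t t0 (fun s st => @ex_derive _ _ _ _ _ _ _ (dphi s st)).
have cT := subset_itv_oo_cc ct.
have dc s : s \in `[0, t] -> derivable ('D_u f) (z + c *: u + s *: v) v.
  by move=> st; have [] := df _ (line_in_ball z t0 tr cT st).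
have [d dt E2] := MVT_line t0 dc.
exists (z + c *: u + d *: v).
  exact: (line_in_ball _ t0 tr cT (subset_itv_oo_cc dt)).
move: E; rewrite /phi (@derive_val _ _ _ _ _ _ _ (dphi c cT)) E2 mulrA => <-.
by ring.
Qed.

Lemma schwarz (f : V -> R) z u v :
  (\forall x \near z, [/\ derivable f x u, derivable f x v,
     derivable ('D_u f) x v & derivable ('D_v f) x u]) ->
  {for z, continuous ('D_u ('D_v f))} -> {for z, continuous ('D_v ('D_u f))} ->
  'D_u ('D_v f) z = 'D_v ('D_u f) z.
Proof.
move=> df cuv cvu; apply/eqP; rewrite -subr_eq0 -normr_le0.
apply/ler_addgt0Pl => e e0; rewrite addr0.
have e20 : 0 < e / 2 by rewrite divr_gt0.
move/cvgrPdist_lt : cuv => /(_ _ e20) cuv.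
move/cvgrPdist_lt : cvu => /(_ _ e20) cvu.
have /nbhs_ballP[r /= r0 rP] : \forall x \near z,
    [/\ derivable f x u, derivable f x v, derivable ('D_u f) x v &
        derivable ('D_v f) x u] /\
    (`|'D_u ('D_v f) z - 'D_u ('D_v f) x| < e / 2 /\
     `|'D_v ('D_u f) z - 'D_v ('D_u f) x| < e / 2).
  exact: filterI df (filterI cuv cvu).
(* The [+ 1] keeps the denominator positive when [u] and [v] both vanish. *)
pose t := r / (`|u| + `|v| + 1) / 2.
have N0 : 0 < `|u| + `|v| + 1 by rewrite ltr_wpDl ?addr_ge0.
have t0 : 0 < t by rewrite /t !divr_gt0.
have tr : t * (`|u| + `|v|) < r.
  rewrite /t mulrAC ltr_pdivrMr// mulrAC ltr_pdivrMr//.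
  rewrite -mulrA ltr_pM2l//; have : 0 <= `|u| + `|v| by rewrite addr_ge0.
  by move: (`|u| + `|v|) => X; lra.
have tr' : t * (`|v| + `|u|) < r by rewrite [`|v| + _]addrC.
have [p pr Ep] := @second_difference f z u v r t t0 tr
  (fun x xr => let: conj (And4 a b c d) _ := rP x xr in conj a c).
have [q qr Eq] := @second_difference f z v u r t t0 tr'
  (fun x xr => let: conj (And4 a b c d) _ := rP x xr in conj b d).
(* The second difference is symmetric in [u] and [v]. The points [p] and [q] differ, but both lie in
   the ball where the mixed derivatives are within [e / 2] of their values at [z]. *)
have {Ep Eq} E : 'D_u ('D_v f) q = 'D_v ('D_u f) p.
  have tt : t * t != 0 by rewrite mulf_neq0// gt_eqF.
  apply: (mulfI tt); apply: etrans (esym Eq) (etrans _ Ep).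
  by have -> : z + t *: v + t *: u = z + t *: u + t *: v; [rewrite addrAC|ring].
have [_ [A _]] := rP _ qr; have [_ [_ B]] := rP _ pr.
move: E A B; move: ('D_u ('D_v f) z) ('D_v ('D_u f) z) ('D_u ('D_v f) q)
  ('D_v ('D_u f) p) => a b c d -> ad bd.
rewrite -(subrKA d) (le_trans (ler_normD _ _))// (splitr e) lerD// ltW//.
by rewrite distrC.
Qed.

End Lines.

(** * Calculus of smooth functions on open sets *)

Section SmoothFunctions.
Context {R : realType}.
Implicit Types V W : normedModType R.

Lemma near_eq_differentiable V W (f g : V -> W) x :
  (\near x, f x = g x) -> differentiable f x -> differentiable g x.
Proof.
move=> fg df.
have cdf : continuous ('d f x) by exact: diff_continuous.
have G : g \o shift x = cst (g x) + 'd f x +o_ 0 id.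
  apply/eqaddoP => e e0.
  have /eqaddoP/(_ e e0) := diff_locally df.
  have fg0 : \forall h \near (0:V), f (h + x) = g (h + x).
    by move: fg; rewrite (near_shift 0 x) /= subr0.
  apply: filterS2 fg0 => h /= fgh.
  have -> // : (g \o shift x - (cst (g x) + 'd f x)) h =
         (f \o shift x - (cst (f x) + 'd f x)) h.
  by rewrite !fctE /= -(nbhs_singleton fg) -fgh.
apply/diff_locallyP; rewrite (diff_unique cdf G); split => //.
Qed.

Lemma differentiable_mx V m n (f : V -> 'M[R]_(m, n)) x :
  (forall i j, differentiable (fun z => f z i j) x) -> differentiable f x.
Proof.
move=> df; have -> : f = \sum_i \sum_j (fun z => f z i j *: delta_mx i j).
  apply/funext => z; rewrite [LHS]matrix_sum_delta fct_sumE.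
  by apply: eq_bigr => i _; rewrite fct_sumE.
by do 2 (apply: differentiable_sum => ?); exact: differentiableZl.
Qed.

Section Direction.
Context {V W : normedModType R}.
Variables (f : V -> W) (z : V).
Hypothesis df : differentiable f z.

Lemma deriveDdir u v : 'D_(u + v) f z = 'D_u f z + 'D_v f z.
Proof. by rewrite !deriveE// linearD. Qed.

Lemma deriveZdir a v : 'D_(a *: v) f z = a *: 'D_v f z.
Proof. by rewrite !deriveE// linearZ. Qed.

Lemma derive_sumdir I (r : seq I) (u : I -> V) :
  'D_(\sum_(i <- r) u i) f z = \sum_(i <- r) 'D_(u i) f z.
Proof.
rewrite deriveE// linear_sum; apply: eq_bigr => i _.
by rewrite deriveE.
Qed.

End Direction.

Section Ck.
Context {V W : normedModType R}.
Implicit Types (U : set V) (f g : V -> W).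

Lemma CkS k U f : Ck k.+1 U f -> Ck k U f.
Proof.
elim: k f => [f [df _] x Ux|k IH f [df Df]].
  exact: differentiable_continuous (df _ Ux).
by split=> // v; apply: IH; exact: Df.
Qed.

Lemma Ck_eq k U f g : open U -> (forall x, U x -> f x = g x) ->
  Ck k U f -> Ck k U g.
Proof.
move=> oU; elim: k f g => [f g fg cf x Ux|k IH f g fg [df Df]].
  have := cf _ Ux; rewrite /prop_for /continuous_at -fg// => h.
  apply: cvg_trans h; apply: near_eq_cvg.
  by apply: filterS (open_nbhs_nbhs (conj oU Ux)) => y /fg.
have fgx x : U x -> \near x, f x = g x.
  by move=> Ux; apply: filterS (open_nbhs_nbhs (conj oU Ux)) => y /fg.
split=> [x Ux|v].
  exact: near_eq_differentiable (fgx _ Ux) (df _ Ux).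
by apply: IH (Df v) => x Ux; apply: near_eq_derive; exact: fgx.
Qed.

Lemma CkD k U f g : open U -> Ck k U f -> Ck k U g -> Ck k U (f + g).
Proof.
move=> oU; elim: k f g => [f g cf cg x Ux|k IH f g [df Df] [dg Dg]].
  by apply: continuousD; [exact: cf|exact: cg].
split=> [x Ux|v]; first by apply: differentiableD; [exact: df|exact: dg].
apply: (@Ck_eq _ _ ('D_v f + 'D_v g)) => //; last exact: IH (Df v) (Dg v).
by move=> x Ux; rewrite deriveD//; apply: diff_derivable; (exact: df || exact: dg).
Qed.

Lemma smooth_on_derive U f v : smooth_on U f -> smooth_on U ('D_v f).
Proof. by move=> sf k; have [_] := sf k.+1; apply. Qed.

Lemma smooth_on_diff U f z : smooth_on U f -> U z -> differentiable f z.
Proof. by move=> sf; have [+ _] := sf 1%N; apply. Qed.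

Lemma smooth_on_derivable U f z v : smooth_on U f -> U z -> derivable f z v.
Proof. by move=> sf Uz; apply/diff_derivable/(smooth_on_diff sf). Qed.

Lemma smooth_on_continuous U f z : smooth_on U f -> U z -> {for z, continuous f}.
Proof. by move=> sf; exact: (sf 0%N z). Qed.

End Ck.

Lemma CkM V k (U : set V) (f g : V -> R) : open U ->
  Ck k U f -> Ck k U g -> Ck k U (f * g).
Proof.
move=> oU; elim: k f g => [f g cf cg x Ux|k IH f g Cf Cg].
  by apply: continuousM; [exact: cf|exact: cg].
have [df Df] := Cf; have [dg Dg] := Cg.
split=> [x Ux|v]; first by apply: differentiableM; [exact: df|exact: dg].
(* The undifferentiated factors enter the induction at order [k], whence [CkS]. *)
apply: (@Ck_eq _ _ _ _ (f * 'D_v g + g * 'D_v f)) => //; last first.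
  by apply: CkD => //; [exact: IH (CkS Cf) (Dg v)|exact: IH (CkS Cg) (Df v)].
by move=> x Ux; rewrite deriveM//; apply: diff_derivable; (exact: df || exact: dg).
Qed.

Lemma smooth_onM V (U : set V) (f g : V -> R) : open U ->
  smooth_on U f -> smooth_on U g -> smooth_on U (f * g).
Proof. by move=> oU sf sg k; exact: CkM. Qed.

Lemma smooth_schwarz V (U : set V) (f : V -> R) z u v : open U ->
  smooth_on U f -> U z -> 'D_u ('D_v f) z = 'D_v ('D_u f) z.
Proof.
move=> oU sf Uz; apply: schwarz.
- apply: filterS (open_nbhs_nbhs (conj oU Uz)) => x Ux.
  by split; apply: smooth_on_derivable Ux; do ?apply: smooth_on_derive.
- by apply: smooth_on_continuous Uz; do !apply: smooth_on_derive.
- by apply: smooth_on_continuous Uz; do !apply: smooth_on_derive.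
Qed.

End SmoothFunctions.

(** * Derivatives along variable directions in the coordinate space *)

Section CoordinateSpace.
Context {R : realType} {n : nat}.
Local Notation E := ('rV[R]_n * 'rV[R]_n)%type.

Lemma tangent_basis (v : E) :
  v = \sum_k v.1 0 k *: xdir R k + \sum_k v.2 0 k *: ydir R k.
Proof.
have fst_sum (u : 'I_n -> E) : (\sum_k u k).1 = \sum_k (u k).1.
  exact: (big_morph fst).
have snd_sum (u : 'I_n -> E) : (\sum_k u k).2 = \sum_k (u k).2.
  exact: (big_morph snd).
set A := \sum_k _; set B := \sum_k _.
rewrite -[A + B]/(A.1 + B.1, A.2 + B.2) !fst_sum !snd_sum /=.
rewrite [X in (_ + X, _)]big1 ?addr0; last by move=> k _; rewrite scaler0.
rewrite [X in (_, X + _)]big1 ?add0r; last by move=> k _; rewrite scaler0.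
by rewrite -!row_sum_delta -surjective_pairing.
Qed.

Section LinearCompose.
Context {V W Z : normedModType R}.
Variable L : V -> W.
Hypotheses (linL : linear L) (contL : continuous L).

Lemma linear_comp_differentiable (X : Z -> V) z :
  differentiable X z -> differentiable (L \o X) z.
Proof.
pose LM := GRing.isLinear.Build _ _ _ _ _ linL.
pose L' : {linear _ -> _} := HB.pack L LM.
move=> dX; apply: differentiable_comp => //.
exact: (@linear_differentiable _ _ _ L').
Qed.

Lemma is_derive_linear_comp (X : Z -> V) z w dX :
  is_derive z w X dX -> is_derive z w (L \o X) (L dX).
Proof.
move=> [Xz <-]; have C : h^-1 *: (((L \o X) \o shift z) (h *: w) - (L \o X) z)
    @[h --> 0^'] --> L ('D_w X z).
  have -> : (fun h => h^-1 *: (((L \o X) \o shift z) (h *: w) - (L \o X) z)) =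
      L \o (fun h => h^-1 *: ((X \o shift z) (h *: w) - X z)).
    apply/funext => h /=; have LB u v : L (u - v) = L u - L v.
      by rewrite addrC -scaleN1r linL scaleN1r addrC.
    have L0 : L 0 = 0 by rewrite -{1}(subrr 0) LB subrr.
    by rewrite -LB -[_ *: (_ - _) in RHS]addr0 linL L0 addr0.
  by apply: cvg_comp Xz _; exact: contL.
by apply: DeriveDef; [exact: cvgP C|exact: cvg_lim C].
Qed.

End LinearCompose.

Lemma fst_coord_linear k : linear (fun z : E => z.1 0 k : R^o).
Proof. by move=> a u v /=; rewrite !mxE. Qed.

Lemma snd_coord_linear k : linear (fun z : E => z.2 0 k : R^o).
Proof. by move=> a u v /=; rewrite !mxE. Qed.

Lemma fst_coord_continuous k : continuous (fun z : E => z.1 0 k : R^o).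
Proof.
move=> z; apply: (@continuous_comp _ _ _ fst (fun u : 'rV[R]_n => u 0 k)).
  exact: cvg_fst.
exact: coord_continuous.
Qed.

Lemma snd_coord_continuous k : continuous (fun z : E => z.2 0 k : R^o).
Proof.
move=> z; apply: (@continuous_comp _ _ _ snd (fun u : 'rV[R]_n => u 0 k)).
  exact: cvg_snd.
exact: coord_continuous.
Qed.

Lemma derive_basis {W : normedModType R} (f : E -> W) z v : differentiable f z ->
  'D_v f z = \sum_k v.1 0 k *: 'D_(xdir R k) f z +
             \sum_k v.2 0 k *: 'D_(ydir R k) f z.
Proof.
move=> df; rewrite {1}(tangent_basis v) deriveDdir// !derive_sumdir//.
by congr (_ + _); apply: eq_bigr => k _; rewrite deriveZdir.
Qed.

Lemma is_derive_fsum {V W : normedModType R} m (h : 'I_m -> V -> W) z w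
    (dh : 'I_m -> W) :
  (forall k, is_derive z w (h k) (dh k)) ->
  is_derive z w (fun x => \sum_k h k x) (\sum_k dh k).
Proof.
move=> dhk; have -> : (fun x => \sum_k h k x) = \sum_k h k.
  by apply/funext => x; rewrite fct_sumE.
exact: is_derive_sum.
Qed.

Let sum_product_rule (x y p q x' y' p' q' : 'I_n -> R) :
  \sum_k (x k *: p' k + p k *: x' k) + \sum_k (y k *: q' k + q k *: y' k) =
  (\sum_k x k *: p' k + \sum_k y k *: q' k) +
  (\sum_k x' k *: p k + \sum_k y' k *: q k).
Proof.
rewrite addrACA -!big_split /=.
by apply: eq_bigr => k _; congr (_ + _ + (_ + _)); exact: mulrC.
Qed.

(* Expanding [X] along the coordinate vectors reduces this to the product rule
   and the symmetry of second derivatives. *)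
Lemma derive_along (U : set E) (f : E -> R) (X : E -> E) z w : open U ->
  smooth_on U f -> U z -> differentiable X z ->
  is_derive z w (fun z => 'D_(X z) f z)
    ('D_(X z) ('D_w f) z + 'D_('D_w X z) f z).
Proof.
move=> oU sf Uz dX.
pose g x := \sum_(k < n) (X x).1 0 k * 'D_(xdir R k) f x +
            \sum_(k < n) (X x).2 0 k * 'D_(ydir R k) f x.
apply: (@near_eq_is_derive _ _ _ g).
  apply: filterS (open_nbhs_nbhs (conj oU Uz)) => x Ux.
  exact: esym (derive_basis _ (smooth_on_diff sf Ux)).
have dXw : is_derive z w X ('D_w X z) by exact/derivableP/diff_derivable.
have d1 k : is_derive z w (fun z => (X z).1 0 k) (('D_w X z).1 0 k).
  exact: (is_derive_linear_comp (fst_coord_linear k) (@fst_coord_continuous k)).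
have d2 k : is_derive z w (fun z => (X z).2 0 k) (('D_w X z).2 0 k).
  exact: (is_derive_linear_comp (snd_coord_linear k) (@snd_coord_continuous k)).
have df v : is_derive z w ('D_v f) ('D_v ('D_w f) z).
  rewrite (smooth_schwarz _ _ oU sf Uz); apply: derivableP.
  exact: smooth_on_derivable (smooth_on_derive v sf) Uz.
have dg1 k := is_deriveM (d1 k) (df (xdir R k)).
have dg2 k := is_deriveM (d2 k) (df (ydir R k)).
apply: is_derive_eq (is_deriveD (is_derive_fsum dg1) (is_derive_fsum dg2)) _.
rewrite (derive_basis (X z) (smooth_on_diff (smooth_on_derive w sf) Uz)).
rewrite (derive_basis ('D_w X z) (smooth_on_diff sf Uz)).
exact: (sum_product_rule (fun k => (X z).1 0 k) (fun k => (X z).2 0 k)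
  (fun k => 'D_(xdir R k) f z) (fun k => 'D_(ydir R k) f z)
  (fun k => ('D_w X z).1 0 k) (fun k => ('D_w X z).2 0 k)
  (fun k => 'D_(xdir R k) ('D_w f) z) (fun k => 'D_(ydir R k) ('D_w f) z)).
Qed.
End CoordinateSpace.

(** * The Picard-Lindelof theorem *)

Section RowVectorCurves.
Context {R : realType} {m : nat}.
Implicit Types (g G : R -> 'rV[R]_m).

Lemma is_derive_mx {V : normedModType R} p q (M : V -> 'M[R]_(p, q)) x v
    (dM : 'M[R]_(p, q)) :
  (forall i j, is_derive x v (fun x => M x i j) (dM i j)) -> is_derive x v M dM.
Proof.
move=> dMij; have dMx : derivable M x v by apply/derivable_mxP => i j.
apply: DeriveDef => //; rewrite derive_mx//; apply/matrixP => i j.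
by rewrite mxE; exact: derive_val.
Qed.

Lemma is_derive_coord {V : normedModType R} p q (M : V -> 'M[R]_(p, q)) x v
    (dM : 'M[R]_(p, q)) i j :
  is_derive x v M dM -> is_derive x v (fun x => M x i j) (dM i j).
Proof.
move=> [dMx <-]; rewrite derive_mx// mxE; apply: derivableP.
by have /derivable_mxP := dMx; apply.
Qed.

Lemma rV_norm_le (u : 'rV[R]_m) B : 0 <= B -> (forall j, `|u 0 j| <= B) -> `|u| <= B.
Proof.
move=> B0 uB; rewrite [leLHS]/Num.Def.normr/= mx_normrE bigmax_le// => -[i j] _ /=.
by rewrite ord1.
Qed.

Lemma rV_coord_le (u : 'rV[R]_m) j : `|u 0 j| <= `|u|.
Proof.
rewrite [leRHS]/Num.Def.normr/= mx_normrE.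
exact: (le_bigmax _ (fun ij : 'I_1 * 'I_m => `|u ij.1 ij.2|) (0, j)).
Qed.

Lemma antiderivative (h : R -> R) (a : R) : continuous h ->
  exists H : R -> R, forall x : R, a < x -> is_derive x 1 H (h x).
Proof.
move=> ch; exists (fun x => \int[lebesgue_measure]_(t in `[a, x]) h t)%R => x ax.
(* Integrability up to [x + 1] makes [x] an interior point for the fundamental theorem of
   calculus. *)
have x1 : x < x + 1 by rewrite ltrDl.
have ih : lebesgue_measure.-integrable `[a, x + 1] (EFin \o h).
  apply: continuous_compact_integrable; first exact: segment_compact.
  exact/continuous_subspaceT.
have [dH Hx] := continuous_FTC1_closed x1 ih ax (ch x).
by apply: DeriveDef; [exact: dH|exact: etrans (esym (derive1E _ _)) Hx].
Qed.

Lemma rV_antiderivative g (a : R) : continuous g ->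
  exists G, forall x : R, a < x -> is_derive x 1 G (g x).
Proof.
move=> cg; have /choice[H HP] j : exists H : R -> R, forall x : R, a < x ->
    is_derive x 1 H (g x 0 j).
  apply: antiderivative => x.
  apply: (@continuous_comp _ _ _ g (fun u : 'rV[R]_m => u 0 j)); first exact: cg.
  exact: coord_continuous.
exists (fun x => \row_j H j x) => x ax; apply: is_derive_mx => i j.
rewrite ord1; have -> : (fun x => (\row_j H j x) 0 j) = H j.
  by apply/funext => y; rewrite mxE.
exact: HP.
Qed.

(** No constant is lost: the norm is the maximum of the coordinates, so the real mean value theorem
    can be used in each of them, with a different intermediate point each time. *)
Lemma mean_value_ineq g (dg : R -> 'rV[R]_m) (a b B : R) : a <= b -> 0 <= B ->
  {within `[a, b], continuous g} ->
  (forall x : R, x \in `]a, b[ -> is_derive x 1 g (dg x)) ->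
  (forall x : R, x \in `]a, b[ -> `|dg x| <= B) ->
  `|g b - g a| <= B * (b - a).
Proof.
rewrite le_eqVlt => /predU1P[<-|ab] B0 cg dgx dgB.
  by rewrite !subrr normr0 mulr0.
apply: rV_norm_le => [|j]; first by rewrite mulr_ge0// subr_ge0 ltW.
have [x xab] : exists2 c, c \in `]a, b[ & g b 0 j - g a 0 j = dg c 0 j * (b - a).
  apply: (MVT (f := fun x => g x 0 j) (df := fun x => dg x 0 j) ab) => [x xab|].
    by apply: is_derive_coord; exact: dgx.
  move=> x; apply: (@continuous_comp _ _ _ (g : subspace `[a, b] -> _)
    (fun u : 'rV[R]_m => u 0 j)); first exact: cg.
  exact: coord_continuous.
rewrite !mxE => ->; rewrite normrM [`|b - a|]ger0_norm ?subr_ge0 ?(ltW ab)//.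
rewrite ler_wpM2r ?subr_ge0 ?(ltW ab)//.
by apply: le_trans (rV_coord_le _ _) _; exact: dgB.
Qed.

Lemma mean_value_ineq01 g (dg : R -> 'rV[R]_m) (B : R) : 0 <= B ->
  (forall x : R, x \in `[0, 1] -> is_derive x 1 g (dg x)) ->
  (forall x : R, x \in `[0, 1] -> `|dg x| <= B) ->
  `|g 1 - g 0| <= B.
Proof.
move=> B0 dgx dgB; rewrite -[B]mulr1 -{2}(subr0 1).
apply: (mean_value_ineq ler01 B0 _ (fun x xi => dgx x (subset_itv_oo_cc xi))
  (fun x xi => dgB x (subset_itv_oo_cc xi))).
by apply: derivable_within_continuous => x /dgx[].
Qed.

(** The bound is asked only at points no farther from [t] than [s] is, so that [B] may itself depend
    on [|s - t|]; this is how a quadratic remainder is obtained later. The endpoints may lie on the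
    boundary, where only continuity is known. *)
Lemma mean_value_ineq_dist g (dg : R -> 'rV[R]_m) (r s t B : R) : 0 <= B ->
  continuous g ->
  (forall x : R, `|x| < r -> is_derive x 1 g (dg x)) ->
  `|s| <= r -> `|t| <= r ->
  (forall x : R, `|x| < r -> `|x - t| <= `|s - t| -> `|dg x| <= B) ->
  `|g s - g t| <= B * `|s - t|.
Proof.
move=> B0 cg dgx sr tr dgB.
have [ts|st] := leP t s.
  rewrite [`|s - t|]ger0_norm ?subr_ge0//.
  have in_r x : x \in `]t, s[ -> `|x| < r.
    rewrite in_itv /= => /andP[tx xs].
    move: sr tr; rewrite !ler_norml ltr_norml => /andP[_ a] /andP[b _].
    by rewrite (le_lt_trans b tx) (lt_le_trans xs a).
  apply: (mean_value_ineq ts B0 _ (fun x xi => dgx x (in_r x xi))).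
    exact: continuous_subspaceT.
  move=> x xi; apply: dgB; first exact: in_r.
  move: xi; rewrite in_itv /= => /andP[tx xs].
  by rewrite !ger0_norm ?subr_ge0 ?(ltW tx)// lerD2r ltW.
rewrite distrC [`|s - t|]distrC [`|t - s|]ger0_norm ?subr_ge0 ?(ltW st)//.
have in_r x : x \in `]s, t[ -> `|x| < r.
  rewrite in_itv /= => /andP[tx xs].
  move: sr tr; rewrite !ler_norml ltr_norml => /andP[a _] /andP[_ b].
  by rewrite (le_lt_trans a tx) (lt_le_trans xs b).
apply: (mean_value_ineq (ltW st) B0 _ (fun x xi => dgx x (in_r x xi))).
  exact: continuous_subspaceT.
move=> x xi; apply: dgB; first exact: in_r.
move: xi; rewrite in_itv /= => /andP[tx xs].
by rewrite distrC [leRHS]distrC !ger0_norm ?subr_ge0 ?(ltW xs) ?(ltW st)// lerB// ltW.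
Qed.

End RowVectorCurves.

Section Picard.
Context {R : realType} {m : nat}.
Variables (f : 'rV[R]_m -> 'rV[R]_m) (x0 : 'rV[R]_m) (r L : R).
Hypotheses (r0 : 0 < r) (L0 : 0 < L).
Hypothesis f_lip : forall x y, `|x - x0| <= r -> `|y - x0| <= r ->
  `|f x - f y| <= L * `|x - y|.

(** [B] bounds [f] on the ball, the [+ 1] making it positive. In [delta], the term [r / B] keeps the
    iterates inside the ball and [1 / (2 L)] makes the Picard map contract by one half. *)
Let B := `|f x0| + L * r + 1.
Let delta := Num.min (r / B) (L *+ 2)^-1.

Let B_gt0 : 0 < B.
Proof. by rewrite /B ltr_wpDl// addr_ge0// mulr_ge0// ltW. Qed.

Let f_bounded x : `|x - x0| <= r -> `|f x| <= B.
Proof.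
move=> xr; rewrite -[f x](subrK (f x0)) (le_trans (ler_normD _ _))//.
have x00 : `|x0 - x0| <= r by rewrite subrr normr0 ltW.
rewrite addrC /B -addrA lerD2l (le_trans (f_lip xr x00))//.
by rewrite (@le_trans _ _ (L * r)) ?ler_wpM2l ?(ltW L0)// lerDl.
Qed.

Let delta_gt0 : 0 < delta.
Proof. by rewrite /delta lt_min divr_gt0//= invr_gt0 pmulrn_lgt0. Qed.

Let B_delta : B * delta <= r.
Proof. by rewrite mulrC -ler_pdivlMr// /delta ge_min lexx. Qed.

Let L_delta : L * delta <= 2^-1.
Proof.
rewrite mulrC -ler_pdivlMr// -invfM [2 * L]mulr_natl.
by rewrite /delta ge_min lexx orbT.
Qed.

(** Freezing curves outside the interval of existence makes them total and continuous on all of [R],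
    so that no restricted domain has to be carried through the iteration. *)
Let clamp (t : R) : R := Num.max (- delta) (Num.min t delta).

Let clamp_norm t : `|clamp t| <= delta.
Proof.
rewrite ler_norml /clamp le_max lexx/= ge_max ge_min lexx orbT andbT.
by rewrite (@le_trans _ _ 0)// ?oppr_le0 ltW.
Qed.

Let clamp_id t : `|t| <= delta -> clamp t = t.
Proof. by rewrite ler_norml /clamp => /andP[a b]; rewrite (min_l b) max_r. Qed.

Let clamp_continuous : continuous clamp.
Proof.
move=> t; apply: (@continuous_max _ _ (cst (- delta)) (id \min cst delta)).
  exact: cst_continuous.
by apply: (@continuous_min _ _ id); [exact: cvg_id|exact: cst_continuous].
Qed.

(** The invariant of the iteration. Its Lipschitz clause is uniform over the iterates and supplies
    one of the two factors [|s - t|] of the estimate [taylor]. *)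
Let good (c : R -> 'rV[R]_m) :=
  [/\ continuous c, forall t, `|c t - x0| <= r, c 0 = x0 &
   forall s t, `|s| <= delta -> `|t| <= delta -> `|c s - c t| <= B * `|s - t|].

Let picard_step (c d : R -> 'rV[R]_m) :=
  forall t : R, `|t| < delta -> is_derive t 1 d (f (c t)).

Let f_comp_continuous c : good c -> continuous (f \o c).
Proof.
case=> cc cr _ _ t; apply/cvgrPdist_le => e e0.
have /cvgrPdist_le/(_ (e / L)) := cc t; rewrite divr_gt0// => /(_ isT).
apply: filterS => s cts; rewrite (le_trans (f_lip (cr _) (cr _)))//.
by rewrite mulrC -ler_pdivlMr.
Qed.

Let step_exists c : good c -> exists2 d, good d & picard_step c d.
Proof.
move=> gc; have [cc cr c0 _] := gc.
(* The antiderivative is differentiable only strictly to the right of its base point, which is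
   therefore taken to the left of [- delta]. *)
have [G dG] := rV_antiderivative (- delta - 1) (f_comp_continuous gc).
pose d t := G (clamp t) - G 0 + x0.
have clamp_in t : - delta - 1 < clamp t.
  have := clamp_norm t; rewrite ler_norml => /andP[+ _].
  by apply: lt_le_trans; rewrite ltrBlDr ltrDl.
have cd : continuous d.
  move=> t; rewrite /d; apply: cvgD; last exact: cvg_cst.
  apply: cvgB; last exact: cvg_cst.
  apply: continuous_comp; first exact: clamp_continuous.
  apply/differentiable_continuous/derivable1_diffP.
  exact: (@ex_derive _ _ _ _ _ _ _ (dG _ (clamp_in t))).
have d0 : d 0 = x0.
  by rewrite /d clamp_id ?normr0 ?(ltW delta_gt0)// subrr add0r.
have dd : picard_step c d.
  move=> t td; have tin : - delta - 1 < t by rewrite -(clamp_id (ltW td)).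
  apply: (@near_eq_is_derive _ _ _ (fun t => G t + (x0 - G 0)) d).
    have : \forall s \near t, `|s| < delta.
      exact: (cvgr_lt _ (@norm_continuous _ _ t) _ td).
    apply: filterS => s sd; rewrite /d (clamp_id (ltW sd)).
    by rewrite addrAC addrA.
  rewrite -[f (c t)]addr0; apply: is_deriveD; exact: dG.
have dB s t : `|s| <= delta -> `|t| <= delta -> `|d s - d t| <= B * `|s - t|.
  move=> sd td.
  apply: (mean_value_ineq_dist (ltW B_gt0) cd dd sd td) => x _ _.
  exact/f_bounded/cr.
exists d => //; split => // t; rewrite -d0.
have -> : d t = d (clamp t) by rewrite /d (clamp_id (clamp_norm t)).
apply: le_trans (dB _ _ (clamp_norm t) _) _; first by rewrite normr0 ltW.
by rewrite subr0 (le_trans _ B_delta)// ler_wpM2l// ltW.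
Qed.

Let good_cst : good (cst x0).
Proof.
split=> [|t||s t _ _] //; first exact: cst_continuous.
  by rewrite subrr normr0 ltW.
by rewrite subrr normr0 mulr_ge0// ltW.
Qed.

Let iterates_exist : exists c : nat -> R -> 'rV[R]_m,
  forall k, good (c k) /\ picard_step (c k) (c k.+1).
Proof.
pose T := {c | good c}.
have /choice[next nextP] (c : T) : exists d : T, picard_step (sval c) (sval d).
  by have [d gd cd] := step_exists (svalP c); exists (exist _ d gd).
exists (fun k => sval (iter k next (exist _ _ good_cst))) => k; split.
  exact: svalP.
exact: nextP.
Qed.

Theorem picard_lindelof : exists2 d : R, 0 < d &
  exists gamma : R -> 'rV[R]_m, gamma 0 = x0 /\
    forall t, `|t| < d -> `|gamma t - x0| <= r /\
      is_derive t 1 gamma (f (gamma t)).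
Proof.
have [c cP] := iterates_exist; exists delta => //.
have gc k : good (c k) by case: (cP k).
have cr k t : `|c k t - x0| <= r by case: (gc k).
have c0 k : c k 0 = x0 by case: (gc k).
have sc k : picard_step (c k) (c k.+1) by case: (cP k).
(* At the start both curves lie in the ball, hence at distance at most [2 r]. Each further step
   gains the factor [L * delta], at most one half. *)
have contract k t : `|t| <= delta ->
    `|c k.+1 t - c k t| <= (r *+ 2) * 2^-1 ^+ k.
  elim: k t => [|k IH] t td.
    rewrite expr0 mulr1 -(subrKA x0) (le_trans (ler_normD _ _))//.
    by rewrite mulr2n lerD// distrC.
  have cd : continuous (c k.+2 - c k.+1).
    by move=> x; apply: cvgB; [case: (gc k.+2) => + _ _ _|
      case: (gc k.+1) => + _ _ _]; apply.
  have dd (x : R) : `|x| < delta -> is_derive x 1 (c k.+2 - c k.+1)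
      (f (c k.+1 x) - f (c k x)).
    by move=> xd; apply: is_deriveB; exact: sc.
  have K0 : 0 <= (r *+ 2) * 2^-1 ^+ k by rewrite mulr_ge0 ?exprn_ge0 ?mulrn_wge0 ?invr_ge0// ltW.
  have o_d : `|0 : R| <= delta by rewrite normr0 ltW.
  have := @mean_value_ineq_dist _ _ _ _ delta t 0 (L * ((r *+ 2) * 2^-1 ^+ k))
    (mulr_ge0 (ltW L0) K0) cd dd td o_d.
  have -> : (c k.+2 - c k.+1) 0 = 0 by rewrite !fctE !c0 subrr.
  rewrite !subr0 => H; apply: le_trans (H _) _.
    move=> x xd _; apply: le_trans (f_lip (cr _ _) (cr _ _)) _.
    by rewrite ler_wpM2l ?(ltW L0)// IH// ltW.
  rewrite exprS mulrAC [leRHS]mulrCA ler_wpM2r//.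
  by apply: le_trans L_delta; rewrite ler_wpM2l ?(ltW L0).
have cvg_c t : `|t| <= delta -> cvgn (fun k => c k t).
  move=> td.
  have cs : cvgn (series (fun k => c k.+1 t - c k t)).
    apply/cauchy_cvgP/cauchy_seriesP => e e0.
    have /cauchy_cvgP/cauchy_seriesP/(_ e e0) :
        cvgn [normed series (fun k => c k.+1 t - c k t)]; last first.
      apply: filterS => k /=; rewrite ger0_norm ?sumr_ge0//.
      by apply: le_lt_trans; exact: ler_norm_sum.
    apply: (@series_le_cvg _ _ (geometric (r *+ 2) 2^-1)).
    - by move=> k; exact: normr_ge0.
    - by move=> k /=; rewrite mulr_ge0 ?exprn_ge0 ?mulrn_wge0 ?invr_ge0// ltW.
    - by move=> k; exact: contract.
    - by apply: is_cvg_geometric_series; rewrite ger0_norm ?invr_ge0// invf_lt1 ?ltr1n.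
  have -> : (fun k => c k t) = (fun k => c 0%N t + series (fun k => c k.+1 t - c k t) k).
    by apply/funext => k; rewrite /series /= telescope_sumr// addrC subrK.
  by apply: is_cvgD; [exact: is_cvg_cst|exact: cs].
pose gamma t := lim ((c k t) @[k --> \oo]).
have cg t : `|t| <= delta -> c k t @[k --> \oo] --> gamma t by exact: cvg_c.
have gr t : `|t| <= delta -> `|gamma t - x0| <= r.
  move=> td; apply: (@cvgr_to_le _ \oo _ _ (fun k => `|c k t - x0|)); last first.
    by apply: filterE => k; exact: cr.
  by apply: cvg_norm; apply: cvgB; [exact: cg|exact: cvg_cst].
have fcg t : `|t| <= delta -> f (c k t) @[k --> \oo] --> f (gamma t).
  move=> td; apply/cvgrPdist_le => e e0.
  have /cvgrPdist_le/(_ (e / L)) := cg t td; rewrite divr_gt0// => /(_ isT).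
  apply: filterS => k ck; rewrite (le_trans (f_lip (gr _ td) (cr _ _)))//.
  by rewrite mulrC -ler_pdivlMr.
(* Unlike differentiability, this estimate passes to pointwise limits. *)
have taylor s t : `|s| < delta -> `|t| < delta ->
    `|gamma s - gamma t - (s - t) *: f (gamma t)| <= L * B * `|s - t| * `|s - t|.
  move=> sd td.
  apply: (@cvgr_to_le _ \oo _ _ (fun k => `|c k.+1 s - c k.+1 t - (s - t) *: f (c k t)|)).
    apply: cvg_norm; apply: cvgB; last by apply: cvgZl_tmp; exact/fcg/ltW.
    by apply: cvgB; [have := cg s (ltW sd)|have := cg t (ltW td)];
      rewrite -(cvg_shiftS).
  apply: filterE => k.
  (* Subtracting the linear part leaves the derivative [f (c k x) - f (c k t)], at most
     [L * B * |x - t|] by the Lipschitz bounds on [f] and on [c k]. *)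
  pose h x := c k.+1 x - x *: f (c k t).
  have ch : continuous h.
    move=> x; apply: cvgB; first by case: (gc k.+1) => + _ _ _; apply.
    exact: (@scalel_continuous _ _ (f (c k t)) x).
  have dh (x : R) : `|x| < delta -> is_derive x 1 h (f (c k x) - f (c k t)).
    move=> xd; apply: is_deriveB; first exact: sc.
    apply: DeriveDef; first exact/diff_derivable.
    by rewrite deriveE// diff_val scale1r.
  have E : c k.+1 s - c k.+1 t - (s - t) *: f (c k t) = h s - h t.
    rewrite /h scalerBl !opprB addrACA [RHS]addrACA; congr (_ + _); exact: addrC.
  rewrite E; apply: (mean_value_ineq_dist _ ch dh (ltW sd) (ltW td)).
    by rewrite !mulr_ge0// ltW.
  move=> x xd xt; apply: le_trans (f_lip (cr _ _) (cr _ _)) _.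
  rewrite -mulrA ler_wpM2l ?(ltW L0)//.
  case: (gc k) => _ _ _ /(_ x t (ltW xd) (ltW td)) H; apply: le_trans H _.
  by rewrite ler_wpM2l ?(ltW B_gt0).
exists gamma; split.
  rewrite /gamma; have -> : c^~ 0 = cst x0 by apply/funext => k; exact: c0.
  exact: lim_cst.
move=> t td; split; first by exact/gr/ltW.
have C : h^-1 *: ((gamma \o shift t) (h *: 1) - gamma t) @[h --> 0^'] --> f (gamma t).
  have LB : 0 < L * B by rewrite mulr_gt0.
  apply/cvgrPdist_le => e e0; near=> h.
  have h0 : h != 0 by near: h; exact: nbhs_dnbhs_neq.
  have hd : `|h| < delta - `|t|.
    by near: h; apply: dnbhs0_lt; rewrite subr_gt0.
  have he : `|h| <= e / (L * B) by near: h; apply: dnbhs0_le; rewrite divr_gt0.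
  have htd : `|h + t| < delta by rewrite (le_lt_trans (ler_normD _ _))// -ltrBrDr.
  have T := taylor _ _ htd td; rewrite addrK in T.
  rewrite /= [h *: 1]mulr1 distrC.
  have -> : h^-1 *: (gamma (h + t) - gamma t) - f (gamma t) =
      h^-1 *: (gamma (h + t) - gamma t - h *: f (gamma t)).
    by rewrite [RHS]scalerBr scalerA mulVf// scale1r.
  rewrite normrZ normfV ler_pdivrMl ?normr_gt0// (le_trans T)//.
  by rewrite -mulrA mulrCA ler_wpM2l// mulrC -ler_pdivlMr.
by apply: DeriveDef; [exact: cvgP C|exact: cvg_lim C].
Unshelve. all: by end_near. Qed.

End Picard.

Lemma smooth_on_linear_comp {R : realType} {V W Z : normedModType R}
    (L : V -> W) (U : set Z) (X : Z -> V) : linear L -> continuous L ->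
  open U -> smooth_on U X -> smooth_on U (L \o X).
Proof.
move=> linL cL oU sX k; elim: k X sX => [|k IH] X sX.
  move=> x Ux; apply: continuous_comp; last exact: cL.
  exact: smooth_on_continuous Ux.
split=> [x Ux|v].
  exact: linear_comp_differentiable (smooth_on_diff sX Ux).
apply: (Ck_eq oU) (IH _ (smooth_on_derive v sX)) => x Ux /=.
have dX := derivableP (smooth_on_derivable (v := v) sX Ux).
exact: esym (@derive_val _ _ _ _ _ _ _ (is_derive_linear_comp linL cL dX)).
Qed.

(** * Local flows of smooth vector fields on the coordinate space *)

Section VectorFields.
Context {R : realType} {n : nat}.
Local Notation E := ('rV[R]_n * 'rV[R]_n)%type.

(** [join] and [parts] carry the problem to row vectors, where the Picard-Lindelof theorem is
    stated, and back. All the norms are maxima, so neither map increases distances and Lipschitz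
    constants survive. *)
Let join (z : E) := row_mx z.1 z.2.
Let parts (u : 'rV[R]_(n + n)) : E := (lsubmx u, rsubmx u).

Let joinK : cancel join parts.
Proof. by case=> a b; rewrite /parts /join row_mxKl row_mxKr. Qed.

Let join_linear : linear join.
Proof. by move=> a u v; rewrite /join /= -add_row_mx -scale_row_mx. Qed.

Let parts_linear : linear parts.
Proof. by move=> a u v; congr pair; apply/rowP => k; rewrite !mxE. Qed.

Let join_norm z : `|join z| <= `|z|.
Proof.
apply: rV_norm_le => // j; rewrite /join mxE.
case: splitP => k _; apply: le_trans (rV_coord_le _ _) _.
  by rewrite [leRHS]/Num.Def.normr/= le_max lexx.
by rewrite [leRHS]/Num.Def.normr/= le_max lexx orbT.
Qed.

Let parts_norm u : `|parts u| <= `|u|.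
Proof.
rewrite [leLHS]/Num.Def.normr/= ge_max !rV_norm_le// => j; rewrite mxE;
  exact: rV_coord_le.
Qed.

Let bounded_linear_continuous {V W : normedModType R} (L : V -> W) :
  linear L -> (forall v, `|L v| <= `|v|) -> continuous L.
Proof.
move=> linL bL z; apply/cvgrPdist_lt => e e0; near=> x.
have -> : L z - L x = L (z - x).
  by rewrite [z - x]addrC -(scaleN1r x) linL scaleN1r addrC.
apply: le_lt_trans (bL _) _; near: x.
have /cvgrPdist_lt := @cvg_id _ (nbhs z); exact.
Unshelve. all: by end_near. Qed.

Let sum_bound (a b : 'I_n -> R) (N : R) : 0 <= N ->
  \sum_k N * a k + \sum_k N * b k <= (\sum_k a k + \sum_k b k + 1) * N.
Proof. by move=> N0; rewrite -!mulr_sumr -mulrDr mulrC ler_wpM2r// lerDl. Qed.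

(** The finitely many derivatives along the basis are continuous, hence bounded near [z0] by their
    norm there plus one. They control every directional derivative, and the mean value inequality is
    applied along segments, balls being convex. *)
Lemma smooth_on_locally_lipschitz m (U : set E) (f : E -> 'rV[R]_m) z0 :
  open U -> smooth_on U f -> U z0 -> exists r L : R, [/\ 0 < r, 0 < L,
    forall z, `|z - z0| <= r -> U z &
    forall x y, `|x - z0| <= r -> `|y - z0| <= r ->
      `|f x - f y| <= L * `|x - y|].
Proof.
move=> oU sf Uz.
have bnd v : \forall x \near z0, `|'D_v f x| <= `|'D_v f z0| + 1.
  have c := smooth_on_continuous (smooth_on_derive v sf) Uz.
  have /= : `|'D_v f x| @[x --> z0] --> `|'D_v f z0| by exact: cvg_norm.
  by move/cvgr_le; apply; rewrite ltrDl.
have bx : \forall x \near z0, forall k : 'I_n,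
    `|'D_(xdir R k) f x| <= `|'D_(xdir R k) f z0| + 1.
  exact: (@filter_forall E 'I_n (fun k x =>
    `|'D_(xdir R k) f x| <= `|'D_(xdir R k) f z0| + 1) _ _ (fun k => bnd _)).
have by_ : \forall x \near z0, forall k : 'I_n,
    `|'D_(ydir R k) f x| <= `|'D_(ydir R k) f z0| + 1.
  exact: (@filter_forall E 'I_n (fun k x =>
    `|'D_(ydir R k) f x| <= `|'D_(ydir R k) f z0| + 1) _ _ (fun k => bnd _)).
have /nbhs_ballP[r /= r0 rP] : \forall x \near z0, [/\ U x,
    forall k : 'I_n, `|'D_(xdir R k) f x| <= `|'D_(xdir R k) f z0| + 1 &
    forall k : 'I_n, `|'D_(ydir R k) f x| <= `|'D_(ydir R k) f z0| + 1].
  by apply: filterS3 bx by_ (open_nbhs_nbhs (conj oU Uz)).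
pose L := \sum_(k < n) (`|'D_(xdir R k) f z0| + 1) +
          \sum_(k < n) (`|'D_(ydir R k) f z0| + 1) + 1.
have L0 : 0 < L.
  by rewrite ltr_wpDl// addr_ge0// sumr_ge0// => k _; rewrite addr_ge0.
have in_ball z : `|z - z0| <= r / 2 -> ball z0 r z.
  rewrite -ball_normE /= distrC => /le_lt_trans; apply.
  by rewrite ltr_pdivrMr// ltr_pMr// ltr1n.
exists (r / 2), L; split => //; first by rewrite divr_gt0.
  by move=> z /in_ball /rP[].
move=> x y xr yr; pose p (t : R) := y + t *: (x - y).
have pr (t : R) : t \in `[0, 1] -> ball z0 r (p t).
  rewrite in_itv /= => /andP[t0 t1]; apply: in_ball.
  have -> : p t - z0 = (1 - t) *: (y - z0) + t *: (x - z0).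
    have xyE : t *: (x - y) = t *: (x - z0) - t *: (y - z0).
      by rewrite -scalerBr opprB addrA subrK.
    by rewrite /p xyE scalerBl scale1r addrAC [t *: _ - _]addrC addrA.
  rewrite (le_trans (ler_normD _ _))// !normrZ !ger0_norm ?subr_ge0//.
  apply: (@le_trans _ _ ((1 - t) * (r / 2) + t * (r / 2))).
    by apply: lerD; apply: ler_wpM2l; rewrite ?subr_ge0.
  by rewrite -mulrDl subrK mul1r.
have dfp (t : R) : t \in `[0, 1] ->
    is_derive t 1 (fun t => f (p t)) ('D_(x - y) f (p t)).
  move=> /pr/rP[Upt _ _].
  by apply: is_derive_line; apply: derivableP; exact: smooth_on_derivable Upt.
have fx : f x = f (p 1) by rewrite /p scale1r addrC subrK.
have fy : f y = f (p 0) by rewrite /p scale0r addr0.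
have K0 : 0 <= L * `|x - y| by rewrite mulr_ge0// ltW.
have dK (t : R) : t \in `[0, 1] -> `|'D_(x - y) f (p t)| <= L * `|x - y|.
  move=> /pr/rP[Upt bxt byt].
rewrite (derive_basis _ (smooth_on_diff sf Upt)).
rewrite (le_trans (ler_normD _ _))//.
apply: (@le_trans _ _ (\sum_(k < n) `|x - y| * (`|'D_(xdir R k) f z0| + 1) +
          \sum_(k < n) `|x - y| * (`|'D_(ydir R k) f z0| + 1))).
  apply: lerD; apply: le_trans (ler_norm_sum _ _ _) _; apply: ler_sum => k _;
    rewrite normrZ; apply: ler_pM => //;
    apply: le_trans (rV_coord_le _ _) _; rewrite [leRHS]/Num.Def.normr/= le_max lexx ?orbT//.
  exact: (sum_bound (fun k => `|'D_(xdir R k) f z0| + 1)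
    (fun k => `|'D_(ydir R k) f z0| + 1) (normr_ge0 (x - y))).
move: K0 dK; move: (L * _) => K K0 dK; rewrite fx fy.
exact: (@mean_value_ineq01 _ _ (fun t => f (p t)) _ K K0 dfp dK).
Qed.

Lemma vector_field_flow (U : set E) (S : E -> E) z0 : open U ->
  smooth_on U S -> U z0 -> exists2 d : R, 0 < d &
  exists gamma : R -> E, gamma 0 = z0 /\
    forall t, `|t| < d -> U (gamma t) /\ is_derive t 1 gamma (S (gamma t)).
Proof.
move=> oU sS Uz.
have cj := bounded_linear_continuous join_linear join_norm.
have cp := bounded_linear_continuous parts_linear parts_norm.
have [r [L [r0 L0 rU fL]]] :=
  smooth_on_locally_lipschitz oU (smooth_on_linear_comp join_linear cj oU sS) Uz.
have partsB u v : parts u - parts v = parts (u - v).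
  by rewrite [u - v]addrC -(scaleN1r v) parts_linear scaleN1r addrC.
have near_z0 u : `|u - join z0| <= r -> `|parts u - z0| <= r.
  by move=> ur; rewrite -{1}(joinK z0) partsB (le_trans (parts_norm _)).
have [|d d0 [c [c0 cP]]] := @picard_lindelof _ _ (join \o S \o parts) (join z0) r L r0 L0.
  move=> x y xr yr; apply: le_trans (fL _ _ (near_z0 _ xr) (near_z0 _ yr)) _.
  by rewrite ler_wpM2l ?(ltW L0)// partsB.
exists d => //; exists (parts \o c); split; first by rewrite /= c0 joinK.
move=> t td; have [ctr dc] := cP t td; split; first exact/rU/near_z0.
have := is_derive_linear_comp parts_linear cp dc.
by rewrite /= joinK.
Qed.

End VectorFields.

(** * Euler-Lagrange equations in a chart *)

Section ChartCalculus.
Context {R : realType} {n : nat}.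
Local Notation E := ('rV[R]_n * 'rV[R]_n)%type.
Implicit Types (f : E -> R) (z v : E) (w : 'rV[R]_n).

Definition xlift w : E := (w, 0).
Definition ylift w : E := (0, w).

Lemma xlift_ylift z : z = xlift z.1 + ylift z.2.
Proof.
by rewrite [LHS]surjective_pairing -[RHS]/(z.1 + 0, 0 + z.2) addr0 add0r.
Qed.

Lemma fst_linear : linear (fst : E -> 'rV[R]_n).
Proof. by []. Qed.

Lemma snd_linear : linear (snd : E -> 'rV[R]_n).
Proof. by []. Qed.

Lemma fst_continuous : continuous (fst : E -> 'rV[R]_n).
Proof. by move=> z; exact: cvg_fst. Qed.

Lemma snd_continuous : continuous (snd : E -> 'rV[R]_n).
Proof. by move=> z; exact: cvg_snd. Qed.

Definition liouville z : E := ylift z.2.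

Lemma liouville_linear : linear liouville.
Proof. by move=> a u v; congr pair; rewrite /= scaler0 addr0. Qed.

Lemma liouville_continuous : continuous liouville.
Proof.
move=> z; apply: differentiable_continuous.
apply: differentiable_pair; first exact: differentiable_cst.
exact: (linear_comp_differentiable snd_linear snd_continuous
  (ex_diff (is_diff_def := is_diff_id z))).
Qed.

Lemma liouville_differentiable z : differentiable liouville z.
Proof.
exact: (linear_comp_differentiable liouville_linear liouville_continuous
  (ex_diff (is_diff_def := is_diff_id z))).
Qed.

Lemma derive_liouville z v : 'D_v liouville z = ylift v.2.
Proof.
exact: (@derive_val _ _ _ _ _ _ _ (is_derive_linear_comp liouville_linear
  liouville_continuous (is_derive_id z v))).
Qed.

(* A copy of ['D_v f] specialised to real functions on the coordinate space: it
   keeps unification away from the normed module instances. *)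
Definition pd v f z : R := 'D_v f z.

Lemma pd_linear_comp f (L : E -> E) z v :
  linear L -> pd v (fun x => f (L x)) z = pd (L v) f (L z).
Proof.
move=> linL; rewrite /pd /derive.
have -> // : (fun h : R => h^-1 *: (((fun x => f (L x)) \o shift z) (h *: v) - f (L z))) =
    (fun h => h^-1 *: ((f \o shift (L z)) (h *: L v) - f (L z))).
by apply/funext => h /=; rewrite linL.
Qed.

Section OnOpenSet.
Variable U : set E.
Hypothesis oU : open U.

Let nearU (P : E -> Prop) z : (forall x, U x -> P x) -> U z -> \forall x \near z, P x.
Proof. by move=> UP Uz; apply: filterS (open_nbhs_nbhs (conj oU Uz)) => x /UP. Qed.

Lemma smooth_on_pd f v : smooth_on U f -> smooth_on U (pd v f).
Proof. exact: smooth_on_derive. Qed.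

Lemma pd_eq_on f g z v : (forall x, U x -> f x = g x) -> U z -> pd v f z = pd v g z.
Proof. by move=> fg Uz; apply: near_eq_derive; exact: nearU. Qed.

Lemma pd_dirD f z u v : smooth_on U f -> U z -> pd (u + v) f z = pd u f z + pd v f z.
Proof. by move=> sf Uz; apply: deriveDdir; exact: smooth_on_diff Uz. Qed.

Lemma pd_dirZ f z a v : smooth_on U f -> U z -> pd (a *: v) f z = a * pd v f z.
Proof. by move=> sf Uz; apply: deriveZdir; exact: smooth_on_diff Uz. Qed.

Lemma pdZ f z a v : smooth_on U f -> U z -> pd v (fun x => a * f x) z = a * pd v f z.
Proof. by move=> sf Uz; apply: deriveZ; exact: smooth_on_derivable Uz. Qed.

Lemma pdM f g z v : smooth_on U f -> smooth_on U g -> U z ->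
  pd v (fun x => f x * g x) z = f z * pd v g z + g z * pd v f z.
Proof.
by move=> sf sg Uz; apply: deriveM; [exact: (smooth_on_derivable sf Uz)|
  exact: (smooth_on_derivable sg Uz)].
Qed.

Lemma pd_xlift f z w : smooth_on U f -> U z ->
  pd (xlift w) f z = \sum_k w 0 k * pd (xdir R k) f z.
Proof.
move=> sf Uz; rewrite [LHS](derive_basis _ (smooth_on_diff sf Uz)) /=.
by rewrite [X in _ + X]big1 ?addr0// => k _; rewrite mxE scale0r.
Qed.

Lemma pd_ylift f z w : smooth_on U f -> U z ->
  pd (ylift w) f z = \sum_k w 0 k * pd (ydir R k) f z.
Proof.
move=> sf Uz; rewrite [LHS](derive_basis _ (smooth_on_diff sf Uz)) /=.
by rewrite [X in X + _]big1 ?add0r// => k _; rewrite mxE scale0r.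
Qed.

Lemma pd_comm f z u v : smooth_on U f -> U z -> pd u (pd v f) z = pd v (pd u f) z.
Proof. by move=> sf Uz; exact: smooth_schwarz oU sf Uz. Qed.

Lemma pd_along f (X : E -> E) z v : smooth_on U f -> U z -> differentiable X z ->
  pd v (fun x => pd (X x) f x) z = pd (X z) (pd v f) z + pd ('D_v X z) f z.
Proof.
move=> sf Uz dX.
exact: (@derive_val _ _ _ _ _ _ _ (derive_along v oU sf Uz dX)).
Qed.

Definition ray_homogeneous f :=
  forall z l, U z -> 0 < l -> f (z.1, l *: z.2) = l * f z.

(** Near [s = 0] the function [f] equals [(1 + s) * f z] at [z + s *: liouville z]; differentiate
    this at [s = 0]. *)
Lemma euler_identity f z : smooth_on U f -> ray_homogeneous f -> U z ->
  pd (liouville z) f z = f z.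
Proof.
move=> sf hf Uz; rewrite /pd.
have D : is_derive z (liouville z) f ('D_(liouville z) f z).
  exact/derivableP/(smooth_on_derivable sf).
have D0 : is_derive (0 : R) 1 (fun s : R => f (z + s *: liouville z))
    ('D_(liouville z) f z).
  by apply: is_derive_line; rewrite scale0r addr0.
have D1 : is_derive (0 : R) 1 (fun s : R => (1 + s) * f z) (f z).
  have D2 : is_derive (0 : R) (1 : R) (fun s : R => s + 1) 1.
    exact: is_derive_shift.
  have -> : (fun s : R => (1 + s) * f z) = f z *: (fun s : R => s + 1).
    by apply/funext => s; rewrite addrC mulrC.
  by apply: is_derive_eq; rewrite -[RHS]mulr1.
rewrite -(@derive_val _ _ _ _ _ _ _ D0) -[RHS](@derive_val _ _ _ _ _ _ _ D1).
apply: near_eq_derive.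
have : \forall s \near (0 : R), -1 < s.
  by apply: (cvgr_gt 0 (@cvg_id _ (nbhs (0 : R)))); rewrite oppr_lt0.
apply: filterS => s s1; have s10 : 0 < 1 + s by rewrite addrC -ltrBlDr sub0r.
apply: etrans (hf z _ Uz s10); congr (f _).
have -> : z + s *: liouville z = (z.1 + s *: 0, z.2 + s *: z.2) by case: (z).
by rewrite scaler0 addr0 scalerDl scale1r.
Qed.

#[local] Opaque pd derive.

Lemma pd_liouville f z v : smooth_on U f -> U z ->
  pd v (fun x => pd (liouville x) f x) z =
  pd v (pd (liouville z) f) z + pd (ylift v.2) f z.
Proof.
move=> sf Uz; rewrite (pd_along v sf Uz (liouville_differentiable z)).
by rewrite derive_liouville (pd_comm v _ sf Uz).
Qed.

(** Infinitesimal form of the 0-homogeneity of fibre derivatives. Differentiate Euler's identity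
    along the fibre: the term coming from the Liouville field itself cancels the right-hand side. *)
Lemma euler_identity_ylift f z w : smooth_on U f -> ray_homogeneous f -> U z ->
  pd (liouville z) (pd (ylift w) f) z = 0.
Proof.
move=> sf hf Uz; have := pd_liouville (ylift w) sf Uz.
rewrite (pd_eq_on _ (fun x => euler_identity sf hf) Uz).
by rewrite (pd_comm _ _ sf Uz) -[LHS]add0r => /addIr.
Qed.

Definition euler_lagrange s f z :=
  forall w, pd s (pd (ylift w) f) z = pd (xlift w) f z.

Lemma euler_lagrange_basis s f z : smooth_on U f -> U z ->
  (forall k, pd s (pd (ydir R k) f) z = pd (xdir R k) f z) ->
  euler_lagrange s f z.
Proof.
move=> sf Uz EL w; rewrite (pd_comm _ _ sf Uz).
rewrite (pd_ylift _ (smooth_on_pd _ sf) Uz) (pd_xlift _ sf Uz).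
by apply: eq_bigr => k _; rewrite -EL (pd_comm _ _ sf Uz).
Qed.

(** Derive the degree-two Euler identity along [s]. The right-hand side gives twice the derivative
    of [f]. On the left, the Euler-Lagrange equation turns the Liouville direction into [xlift z.2],
    which together with [ylift s.2] is [s] itself, so the derivative appears once. *)
Lemma energy_conserved s f z : smooth_on U f -> U z -> s.1 = z.2 ->
  euler_lagrange s f z ->
  (forall x, U x -> pd (liouville x) f x = 2 * f x) -> pd s f z = 0.
Proof.
move=> sf Uz sz EL Ef; have := pd_liouville s sf Uz.
rewrite (pd_eq_on _ Ef Uz) (pdZ _ _ sf Uz) EL -(pd_dirD _ _ sf Uz) -sz -xlift_ylift.
by move: (pd s f z) => a; lra.
Qed.

(** Since [s] annihilates [f], the factor [2 * f] of the fibre derivative of the square behaves as a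
    constant along [s]; it appears on both sides and cancels. *)
Lemma euler_lagrange_sqrt s f z : smooth_on U f -> U z -> f z != 0 ->
  euler_lagrange s (fun x => f x * f x) z -> pd s (fun x => f x * f x) z = 0 ->
  pd s f z = 0 /\ euler_lagrange s f z.
Proof.
move=> sf Uz f0 EL; rewrite (pdM _ sf sf Uz) -mulr2n => /eqP.
rewrite mulrn_eq0/= mulf_eq0 (negPf f0) => /= /eqP Sf0; split=> // w.
have := EL w; have D2 v x : U x -> pd v (fun x => f x * f x) x = 2 * (f x * pd v f x).
  by move=> Ux; rewrite (pdM _ sf sf Ux) mulr2n mulrDl mul1r.
rewrite (pd_eq_on _ (D2 (ylift w)) Uz) (D2 _ _ Uz).
have sw := smooth_on_pd (ylift w) sf.
rewrite (pdZ _ _ (smooth_onM oU sf sw) Uz) (pdM _ sf sw Uz) Sf0 mulr0 addr0.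
by move=> /mulfI; rewrite pnatr_eq0 => /(_ isT) /(mulfI f0).
Qed.

(* The scaling [(x, y) |-> (x, l y)] maps [f] to [l f]. *)
Lemma ray_homogeneous_euler_lagrange f z l s c :
  (forall x t, U x -> 0 < t -> U (x.1, t *: x.2)) ->
  smooth_on U f -> ray_homogeneous f -> U z -> 0 < l -> s.1 = z.2 ->
  euler_lagrange (l *: s.1, l ^+ 2 *: s.2 + c *: z.2) f (z.1, l *: z.2) ->
  euler_lagrange s f z.
Proof.
move=> conicU sf hf Uz l0 sz EL w; pose m (x : E) : E := (x.1, l *: x.2).
have l_neq0 : l != 0 by rewrite gt_eqF.
have linm : linear m.
  by move=> a u v; congr pair; rewrite /= scalerDr !scalerA mulrC.
have Um x : U x -> U (m x) by move=> Ux; exact: conicU.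
have fm v x : U x -> pd (m v) f (m x) = l * pd v f x.
  move=> Ux; rewrite -(pd_linear_comp _ _ _ linm) -(pdZ _ _ sf Ux).
  by apply: pd_eq_on Ux => y Uy; exact: hf.
pose g := pd (ylift w) f; have sg : smooth_on U g := smooth_on_pd _ sf.
have gm x : U x -> g (m x) = g x.
  move=> Ux; have mw : m (ylift w) = l *: ylift w by congr pair; rewrite scaler0.
  have := fm (ylift w) x Ux; rewrite mw (pd_dirZ _ _ sf (Um _ Ux)).
  exact: (mulfI l_neq0).
have Dgm v : pd (m v) g (m z) = pd v g z.
  by rewrite -(pd_linear_comp _ _ _ linm); exact: pd_eq_on Uz.
have := EL w; rewrite -/g -[(z.1, _)]/(m z).
(* The fibre coordinate of [m z] is [l *: z.2], hence the coefficient [c / l]. This Liouville part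
   annihilates [g], by [euler_identity_ylift]. *)
have -> : (l *: s.1, l ^+ 2 *: s.2 + c *: z.2) =
    m (l *: s) + (c / l) *: liouville (m z).
  congr pair; rewrite /= ?scaler0 ?addr0// !scalerA -expr2; congr (_ + _ *: _).
  by rewrite mulfVK.
rewrite (pd_dirD _ _ sg (Um _ Uz)) (pd_dirZ _ _ sg (Um _ Uz)).
rewrite (euler_identity_ylift _ sf hf (Um _ Uz)) mulr0 addr0 Dgm (pd_dirZ _ _ sg Uz).
have mw : m (xlift w) = xlift w by congr pair; rewrite scaler0.
have := fm (xlift w) z Uz; rewrite mw => fmw /esym; rewrite fmw.
by move=> /(mulfI l_neq0).
Qed.

Section Spray.
Variable S : E -> E.
Hypothesis S_fst : forall z, U z -> (S z).1 = z.2.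
Hypothesis S_diff : forall z, U z -> differentiable S z.

(** The base component of a spray is [y], whose fibre derivative along [w] is [w]. This is the
    source of the mixed derivatives in x and y that the symmetrisation removes. *)
Let derive_S_fst z w : U z ->
  'D_(ylift w) S z = xlift w + ylift ('D_(ylift w) S z).2.
Proof.
move=> Uz; rewrite [LHS]xlift_ylift; congr (xlift _ + _).
have dS : is_derive z (ylift w) S ('D_(ylift w) S z).
  exact/derivableP/diff_derivable/S_diff.
have D1 := is_derive_linear_comp fst_linear fst_continuous dS.
rewrite -(@derive_val _ _ _ _ _ _ _ D1).
rewrite (@near_eq_derive _ _ _ _ (snd : E -> _)); last exact: nearU.
have D2 := is_derive_linear_comp snd_linear snd_continuous (is_derive_id z (ylift w)).
exact: (@derive_val _ _ _ _ _ _ _ D2).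
Qed.

Let symmetrise (a b c d e : R) :
  a + (b + d) = c -> a + (c + e) = b -> 2 * a = - (d + e).
Proof. by lra. Qed.

Let halve (a b : R) : 2 * a = - b -> a = - 2^-1 * b.
Proof. by lra. Qed.

(* Differentiate the Euler-Lagrange equation along the fibre and symmetrise:
   the mixed derivatives cancel. *)
Lemma pd_spray_hessian f z u w : smooth_on U f ->
  (forall x, U x -> euler_lagrange (S x) f x) -> U z ->
  2 * pd (S z) (pd (ylift u) (pd (ylift w) f)) z =
  - (pd (ylift ('D_(ylift u) S z).2) (pd (ylift w) f) z +
     pd (ylift ('D_(ylift w) S z).2) (pd (ylift u) f) z).
Proof.
move=> sf EL Uz.
have half u' w' : pd (S z) (pd (ylift u') (pd (ylift w') f)) z
    + (pd (xlift u') (pd (ylift w') f) z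
       + pd (ylift ('D_(ylift u') S z).2) (pd (ylift w') f) z)
    = pd (xlift w') (pd (ylift u') f) z.
  have sg := smooth_on_pd (ylift w') sf.
  have A := pd_dirD (xlift u') (ylift ('D_(ylift u') S z).2) sg Uz.
  have B := pd_along (ylift u') sg Uz (S_diff Uz).
  rewrite derive_S_fst// A in B; apply: etrans (esym B) _.
  apply: etrans (pd_comm (ylift u') (xlift w') sf Uz).
  by apply: pd_eq_on Uz => x Ux; exact: EL.
have sym : pd (S z) (pd (ylift w) (pd (ylift u) f)) z =
    pd (S z) (pd (ylift u) (pd (ylift w) f)) z.
  by apply: pd_eq_on Uz => x Ux; exact: pd_comm sf Ux.
have h1 := half u w; have h2 := half w u; rewrite sym in h2.
exact: (symmetrise h1 h2).
Qed.

Definition yhessian f z : 'M[R]_n :=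
  \matrix_(k, l) pd (ydir R k) (pd (ydir R l) f) z.

(** Writing the fibre part of [S] as -2 G^k, this is the nonlinear connection N^k_l = dG^k/dy^l. *)
Definition spray_connection z : 'M[R]_n :=
  - 2^-1 *: \matrix_(k, l) ('D_(ydir R l) S z).2 0 k.

Let hessian_product (A W : 'M[R]_n) k l : A^T = A ->
  - 2^-1 * (\sum_i W i k * A i l + \sum_i W i l * A i k) =
  ((- 2^-1 *: W)^T *m A + A *m (- 2^-1 *: W)) k l.
Proof.
move=> symA; rewrite !mxE mulrDr !mulr_sumr.
congr (_ + _); apply: eq_bigr => i _; first by rewrite !mxE mulrA.
by rewrite -{1}symA !mxE mulrA mulrC.
Qed.

Lemma pd_yhessian f z k l : smooth_on U f ->
  (forall x, U x -> euler_lagrange (S x) f x) -> U z ->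
  pd (S z) (fun x => yhessian f x k l) z =
  ((spray_connection z)^T *m yhessian f z + yhessian f z *m spray_connection z) k l.
Proof.
move=> sf EL Uz.
have -> : (fun x => yhessian f x k l) = pd (ydir R k) (pd (ydir R l) f).
  by apply/funext => x; rewrite mxE.
have sg i := smooth_on_pd (ydir R i) sf.
have H : 2 * pd (S z) (pd (ydir R k) (pd (ydir R l) f)) z =
  - (pd (ylift ('D_(ydir R k) S z).2) (pd (ydir R l) f) z +
     pd (ylift ('D_(ydir R l) S z).2) (pd (ydir R k) f) z).
  exact: pd_spray_hessian (delta_mx 0 k) (delta_mx 0 l) sf EL Uz.
have E1 := pd_ylift ('D_(ydir R k) S z).2 (sg l) Uz.
have E2 := pd_ylift ('D_(ydir R l) S z).2 (sg k) Uz.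
apply: etrans (halve (etrans H (f_equal2 (fun a b => - (a + b)) E1 E2))) _.
have symA : (yhessian f z)^T = yhessian f z.
  by apply/matrixP => i j; rewrite !mxE; exact: pd_comm sf Uz.
apply: etrans (hessian_product (\matrix_(k, l) ('D_(ydir R l) S z).2 0 k) k l symA).
apply: (f_equal ( *%R _)); apply: f_equal2; apply: eq_bigr => i _.
  by apply: f_equal2; apply: esym; [exact: mxE|exact: mxE].
by apply: f_equal2; apply: esym; [exact: mxE|exact: mxE].
Qed.

End Spray.

End OnOpenSet.

End ChartCalculus.

(** * The determinant of a pencil *)

Section MatrixAlgebra.
Context {K : comNzRingType} {n : nat}.
Implicit Types A B N : 'M[K]_n.

Definition replace_row A B i : 'M[K]_n :=
  \matrix_(j, k) if j == i then B j k else A j k.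

(** Expand each determinant along its replaced row: the cofactors there are those of [A]. With [B]
    the derivative of [A], this is the algebraic half of Jacobi's formula. *)
Lemma sum_det_replace_row A B :
  \sum_i \det (replace_row A B i) = \tr (B *m \adj A).
Proof.
apply: eq_bigr => i _; rewrite (expand_det_row _ i) [RHS]mxE.
apply: eq_bigr => k _; rewrite !mxE eqxx; congr (_ * (_ * \det _)).
by apply/matrixP => j l; rewrite !mxE eq_sym (negPf (neq_lift _ _)).
Qed.

Lemma trace_congruence_adj A N :
  \tr ((N^T *m A + A *m N) *m \adj A) = (\tr N *+ 2) * \det A.
Proof.
rewrite mulmxDl mxtraceD -mulmxA mul_mx_adj mul_mx_scalar mxtraceZ mxtrace_tr.
rewrite mxtrace_mulC mulmxA mul_adj_mx mul_scalar_mx mxtraceZ.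
by rewrite -mulr2n mulrnAl mulrC.
Qed.

End MatrixAlgebra.

Section PencilDeterminant.
Context {R : realType} {V : normedModType R} {n : nat}.
Variables z v : V.

(** Differentiating coefficient by coefficient involves no topology on polynomials and treats all
    the coefficients of Q at once. *)
Definition is_coef_derive (p : V -> {poly R}) (dp : {poly R}) :=
  forall k, is_derive z v (fun x => (p x)`_k) dp`_k.

Lemma is_coef_deriveC (c : {poly R}) : is_coef_derive (fun=> c) 0.
Proof. by move=> k; rewrite coef0; exact: is_derive_cst. Qed.

Lemma is_coef_derive_sum I (r : seq I) (p : I -> V -> {poly R}) dp :
  (forall i, is_coef_derive (p i) (dp i)) ->
  is_coef_derive (fun x => \sum_(i <- r) p i x) (\sum_(i <- r) dp i).
Proof.
move=> dpi; elim: r => [|i r IH].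
  rewrite big_nil; have -> : (fun x => \sum_(i <- [::]) p i x) = fun=> 0.
    by apply/funext => x; rewrite big_nil.
  exact: is_coef_deriveC.
rewrite big_cons => k.
have -> : (fun x => (\sum_(j <- i :: r) p j x)`_k) =
    (fun x => (p i x)`_k) + (fun x => (\sum_(j <- r) p j x)`_k).
  by apply/funext => x; rewrite big_cons coefD.
by rewrite coefD; exact: is_deriveD (dpi i k) (IH k).
Qed.

Lemma is_coef_deriveM p q dp dq : is_coef_derive p dp -> is_coef_derive q dq ->
  is_coef_derive (fun x => p x * q x) (dp * q z + p z * dq).
Proof.
move=> Dp Dq k.
have -> : (fun x => (p x * q x)`_k) =
    \sum_(i < k.+1) ((fun x => (p x)`_i) * (fun x => (q x)`_(k - i))).
  by apply/funext => x; rewrite coefM fct_sumE.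
have H (i : 'I_k.+1) := is_deriveM (Dp i) (Dq (k - i)%N).
apply: is_derive_eq (is_derive_sum H) _.
rewrite coefD !coefM -big_split /=; apply: eq_bigr => i _.
by rewrite addrC; congr (_ + _); exact: mulrC.
Qed.

Lemma is_coef_derive_prod m (p : 'I_m -> V -> {poly R}) dp :
  (forall i, is_coef_derive (p i) (dp i)) ->
  is_coef_derive (fun x => \prod_i p i x)
    (\sum_i \prod_j if j == i then dp j else p j z).
Proof.
elim: m p dp => [|m IH] p dp Dp.
  rewrite big_ord0; have -> : (fun x => \prod_i p i x) = fun=> 1.
    by apply/funext => x; rewrite big_ord0.
  exact: is_coef_deriveC.
have -> : (fun x => \prod_i p i x) =
    (fun x => p ord0 x * \prod_i p (lift ord0 i) x).
  by apply/funext => x; rewrite big_ord_recl.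
have := is_coef_deriveM (Dp ord0) (IH _ _ (fun i => Dp (lift ord0 i))).
rewrite big_ord_recl [in X in _ -> is_coef_derive _ X]big_ord_recl eqxx.
have -> : \prod_i (if lift ord0 i == ord0 then dp (lift ord0 i) else p (lift ord0 i) z)
    = \prod_i p (lift ord0 i) z by apply: eq_bigr.
have -> // : \sum_i \prod_j (if j == lift ord0 i then dp j else p j z) =
  p ord0 z * (\sum_i \prod_j (if j == i then dp (lift ord0 j) else p (lift ord0 j) z)).
rewrite mulr_sumr; apply: eq_bigr => i _; rewrite big_ord_recl; congr (_ * _).
Qed.

(** Jacobi's formula. The product rule in the Leibniz expansion differentiates one row at a time,
    giving the determinants of [replace_row]. *)
Lemma is_coef_derive_det (A : V -> 'M[{poly R}]_n) (dA : 'M[{poly R}]_n) :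
  (forall i j, is_coef_derive (fun x => A x i j) (dA i j)) ->
  is_coef_derive (fun x => \det (A x)) (\tr (dA *m \adj (A z))).
Proof.
move=> DA; rewrite -sum_det_replace_row /determinant exchange_big /=.
apply: is_coef_derive_sum => s.
have := is_coef_deriveM (@is_coef_deriveC ((-1) ^+ s))
  (is_coef_derive_prod (fun i => DA i (s i))).
rewrite mul0r add0r mulr_sumr.
have -> // : \sum_i (-1) ^+ s * (\prod_j if j == i then dA j (s j) else A z j (s j)) =
  \sum_i (-1) ^+ s * (\prod_j replace_row (A z) dA i j (s j)).
by apply: eq_bigr => i _; congr (_ * _); apply: eq_bigr => j _; rewrite mxE.
Qed.

Lemma is_coef_derive_polyC (f : V -> R) df : is_derive z v f df ->
  is_coef_derive (fun x => (f x)%:P) df%:P.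
Proof.
move=> Df [|k].
  rewrite coefC /=; have -> // : (fun x => (f x)%:P`_0) = f.
  by apply/funext => x; rewrite coefC.
rewrite coefC /=; have -> : (fun x => (f x)%:P`_k.+1) = cst 0.
  by apply/funext => x; rewrite coefC.
exact: is_derive_cst.
Qed.

(** Pulling [g] out of the pencil leaves a scalar inverse to differentiate instead of the inverse
    matrix [invmx g]. *)
Lemma det_pencil (g B : 'M[R]_n) : g \in unitmx ->
  \det (map_mx polyC (invmx g *m B) + 'X%:M) =
  (\det g)^-1 *: \det (map_mx polyC B + 'X *: map_mx polyC g).
Proof.
move=> ug; have dg0 : \det g != 0 by rewrite -unitfE -unitmxE.
have -> : map_mx polyC B + 'X *: map_mx polyC g =
    map_mx polyC g *m (map_mx polyC (invmx g *m B) + 'X%:M).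
  by rewrite mulmxDr -map_mxM mulKVmx// mul_mx_scalar.
by rewrite det_mulmx det_map_mx mul_polyC scalerA mulVf// scale1r.
Qed.

(* Both [\det g] and the determinant of the pencil [B + 'X g] satisfy
   [D d = 2 tr(N) d], so their quotient is constant to first order. *)
Lemma is_derive_pencil_charpoly (g B : V -> 'M[R]_n) (N : 'M[R]_n) k :
  (forall i j, is_derive z v (fun x => g x i j) ((N^T *m g z + g z *m N) i j)) ->
  (forall i j, is_derive z v (fun x => B x i j) ((N^T *m B z + B z *m N) i j)) ->
  (\forall x \near z, g x \in unitmx) ->
  is_derive z v
    (fun x => (\det (map_mx polyC (invmx (g x) *m B x) + 'X%:M))`_k) 0.
Proof.
move=> Dg DB ug.
pose P x := \det (map_mx polyC (B x) + 'X *: map_mx polyC (g x)).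
pose t : R := \tr N *+ 2.
have DP : is_coef_derive P (t%:P * P z).
  have := @is_coef_derive_det (fun x => map_mx polyC (B x) + 'X *: map_mx polyC (g x))
    ((map_mx polyC N)^T *m (map_mx polyC (B z) + 'X *: map_mx polyC (g z)) +
     (map_mx polyC (B z) + 'X *: map_mx polyC (g z)) *m map_mx polyC N).
  rewrite trace_congruence_adj -/(P z).
  have -> : \tr (map_mx polyC N) *+ 2 = t%:P by rewrite trace_map_mx -raddfMn.
  apply=> i j.
  (* The two terms are indexed by [bool] so that [is_coef_derive_sum] applies to them. As [N] is
     free of ['X], the pencil obeys the same equation as [B] and [g]. *)
  have -> : (fun x => (map_mx polyC (B x) + 'X *: map_mx polyC (g x)) i j) =
      (fun x => \sum_(b : bool) (if b then (B x i j)%:P else 'X * (g x i j)%:P)).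
    by apply/funext => x; rewrite big_bool !mxE.
  have -> : ((map_mx polyC N)^T *m (map_mx polyC (B z) + 'X *: map_mx polyC (g z)) +
     (map_mx polyC (B z) + 'X *: map_mx polyC (g z)) *m map_mx polyC N) i j =
    \sum_(b : bool) if b then ((N^T *m B z + B z *m N) i j)%:P else
      (0 * (g z i j)%:P + 'X * ((N^T *m g z + g z *m N) i j)%:P).
    rewrite big_bool /= mul0r add0r mulmxDr mulmxDl -scalemxAr -scalemxAl.
    rewrite addrACA -scalerDr map_trmx -!map_mxM -!map_mxD.
    by rewrite [LHS]mxE [in X in X + _]mxE [in X in _ + X]mxE [in X in _ + X]mxE.
  apply: is_coef_derive_sum => -[]; first exact: is_coef_derive_polyC.
  by apply: is_coef_deriveM; [exact: is_coef_deriveC|exact: is_coef_derive_polyC].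
have Dd : is_derive z v (fun x => \det (g x)) (t * \det (g z)).
  have Ddet := @is_coef_derive_det (fun x => map_mx polyC (g x))
    ((map_mx polyC N)^T *m map_mx polyC (g z) + map_mx polyC (g z) *m map_mx polyC N).
  have /Ddet/(_ 0%N) : forall i j, is_coef_derive (fun x => map_mx polyC (g x) i j)
     (((map_mx polyC N)^T *m map_mx polyC (g z) + map_mx polyC (g z) *m map_mx polyC N) i j).
    move=> i j; have -> : (fun x => map_mx polyC (g x) i j) = (fun x => (g x i j)%:P).
      by apply/funext => x; rewrite mxE.
    rewrite map_trmx -!map_mxM -!map_mxD mxE.
    exact: is_coef_derive_polyC.
  rewrite trace_congruence_adj trace_map_mx -raddfMn det_map_mx -polyCM coefC /=.
  have -> // : (fun x => (\det (map_mx polyC (g x)))`_0) = (fun x => \det (g x)).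
  by apply/funext => x; rewrite det_map_mx coefC.
have ugz := nbhs_singleton ug.
have dz0 : \det (g z) != 0 by rewrite -unitfE -unitmxE.
apply: (@near_eq_is_derive _ _ _ (fun x => (\det (g x))^-1 * (P x)`_k)).
  by apply: filterS ug => x ux; rewrite det_pencil// coefZ.
have DV : is_derive z v (fun x => (\det (g x))^-1)
    (- (\det (g z)) ^- 2 *: (t * \det (g z))).
  have [dd <-] := Dd.
  by apply: DeriveDef; [exact: derivableV|exact: deriveV].
apply: is_derive_eq (is_deriveM DV (DP k)) _.
rewrite coefCM; move: dz0; move: (\det (g z)) ((P z)`_k) => d p d0.
transitivity (d^-1 * (t * p) + p * (- (d ^+ 2)^-1 * (t * d))); first by [].
by field.
Qed.

End PencilDeterminant.

(** * Integral curves and geodesics *)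

Lemma is_derive_curve_comp {R : realType} {V W : normedModType R} (G : V -> W)
    (gamma : R -> V) (t : R) v :
  is_derive t 1 gamma v -> differentiable G (gamma t) ->
  is_derive t 1 (G \o gamma) ('D_v G (gamma t)).
Proof.
move=> [dg <-] dG; have dg' : differentiable gamma t by exact/derivable1_diffP.
have dGg : differentiable (G \o gamma) t by exact: differentiable_comp.
apply: DeriveDef; first exact: diff_derivable.
apply: etrans (deriveE _ dGg) _; apply: etrans (esym (deriveE _ dG)).
have E := diff_comp dg' dG.
apply: etrans (f_equal (fun h => h 1) E) _ => /=.
by apply: f_equal; exact: esym (deriveE _ dg').
Qed.

Section Charts.
Context {R : realType} {n : nat} {M : smooth_manifold R n}.
Local Notation E := ('rV[R]_n * 'rV[R]_n)%type.
Implicit Types (i j : mindex M) (z : E).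

Lemma slit_range_open i : open (slit_range i).
Proof.
apply: openI.
  apply: (@open_comp _ _ (fst : E -> _) (mrange i)) => [z _|]; first exact: fst_continuous.
  exact: mrange_open.
apply: (@open_comp _ _ (snd : E -> _) [set y | y != 0]) => [z _|]; first exact: snd_continuous.
have -> : [set y : 'rV[R]_n | y != 0] = ~` [set 0].
  by apply/seteqP; split=> y /= /eqP.
exact/closed_openC/accessible_closed_set1/hausdorff_accessible/norm_hausdorff.
Qed.

Lemma slit_range_conic i z (l : R) : slit_range i z -> 0 < l ->
  slit_range i (z.1, l *: z.2).
Proof.
by move=> [iz z0] l0; split=> //=; rewrite scaler_eq0 negb_or z0 gt_eqF.
Qed.

Definition overlap i j : set 'rV[R]_n :=
  [set x | mrange i x /\ mdom j (mpsi i x)].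

Lemma overlap_open i j : open (overlap i j).
Proof. by rewrite openE => x [ix jx]; exact: near_overlap. Qed.

Lemma ttrans_differentiable i j z : overlap i j z.1 ->
  differentiable (ttrans i j) z.
Proof.
move=> ijz; have oO := @overlap_open i j.
have sm : smooth_on (overlap i j) (mtrans i j) := @mtrans_smooth _ _ M i j.
have d_id : differentiable (id : E -> E) z by exact: (ex_diff (is_diff_def := is_diff_id z)).
have dfst : differentiable (fst : E -> 'rV[R]_n) z.
  exact: (linear_comp_differentiable fst_linear fst_continuous d_id).
have dsnd : differentiable (snd : E -> 'rV[R]_n) z.
  exact: (linear_comp_differentiable snd_linear snd_continuous d_id).
apply: differentiable_pair.
  by apply: (@differentiable_comp _ _ _ _ fst) => //; exact: smooth_on_diff sm ijz.
apply: differentiable_mx => a b; rewrite (ord1 a).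
(* The fibre component differentiates [mtrans i j] in the moving direction [x.2]. Expanded in the
   basis, it involves only fixed directions, for which smoothness applies. *)
pose h (x : E) := \sum_k (x.2 0 k * ('D_(delta_mx 0 k) (mtrans i j) x.1) 0 b).
apply: (@near_eq_differentiable _ _ _ h).
  have : \forall x \near z, overlap i j x.1.
    apply: fst_continuous; exact: open_nbhs_nbhs.
  apply: filterS => x xO; have dx := smooth_on_diff sm xO.
  rewrite [in RHS](row_sum_delta x.2) (derive_sumdir dx) summxE.
  by apply: eq_bigr => k _; rewrite (deriveZdir dx) mxE.
have -> : h = \sum_k ((fun x : E => x.2 0 k) *
    (fun x : E => ('D_(delta_mx 0 k) (mtrans i j) x.1) 0 b)).
  by apply/funext => x; rewrite fct_sumE.
apply: differentiable_sum => k; apply: differentiableM.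
  apply: (@differentiable_comp _ _ _ _ snd (fun y : 'rV[R]_n => y 0 k)) => //.
  exact: differentiable_coord.
apply: (@differentiable_comp _ _ _ _ (fun x : E => 'D_(delta_mx 0 k) (mtrans i j) x.1)
    (fun y : 'rV[R]_n => y 0 b)); last exact: differentiable_coord.
apply: (@differentiable_comp _ _ _ _ fst ('D_(delta_mx 0 k) (mtrans i j))) => //.
exact: (smooth_on_diff (smooth_on_derive (delta_mx 0 k) sm) ijz).
Qed.

(** Components change linearly between charts, so vanishing in one chart at the base point would
    force vanishing in all of them. *)
Lemma tcomp_neq0 (v : tangent_bundle M) i : slit_tangent_bundle v ->
  mdom i (tpt v) -> tcomp v i != 0.
Proof.
move=> [j vj] iv; apply: contraNneq vj => vi0.
have [jv|jv] := pselect (mdom j (tpt v)); last by rewrite tcomp_out.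
by rewrite (tcomp_trans iv jv) vi0 derive0.
Qed.

Lemma tcoord_slit_range (v : tangent_bundle M) i : slit_tangent_bundle v ->
  mdom i (tpt v) -> slit_range i (tcoord i v).
Proof.
by move=> sv iv; split; [exists (tpt v)|exact: tcomp_neq0].
Qed.

Lemma integral_curve_exists (S : slit_vector_field M) i z : slit_range i z ->
  exists2 d : R, 0 < d & exists gamma : R -> tangent_bundle M,
    [/\ integral_curve S `]-d, d[ gamma, tcoord i (gamma 0) = z &
        forall t, t \in `]-d, d[ -> mdom i (tpt (gamma t))].
Proof.
move=> iz; have [hz _] := iz.
have [d d0 [c [c0 cP]]] := vector_field_flow (@slit_range_open i) (@svf_smooth _ _ _ S i) iz.
exists d => //.
(* [tvec hz] is a default value; it is never taken for [|t| < d]. *)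
pose gamma t := if pselect (mrange i (c t).1) is left h then tvec h else tvec hz.
have in_d (t : R) : t \in `]-d, d[ -> `|t| < d by rewrite in_itv /= ltr_norml.
have near_d (t : R) : `|t| < d -> \forall s \near t, `|s| < d.
  by move=> td; exact: (cvgr_lt _ (@norm_continuous _ _ t) _ td).
have gammaE t : `|t| < d -> exists h : mrange i (c t).1, gamma t = tvec h.
  move=> /cP[[h _] _]; rewrite /gamma; case: pselect => [h'|/(_ h)[]].
  by exists h'.
have pt t : `|t| < d -> tpt (gamma t) = mpsi i (c t).1.
  by move=> /gammaE[h ->].
have cc t : `|t| < d -> {for t, continuous c}.
  by move=> /cP[_ [dc _]]; exact/differentiable_continuous/derivable1_diffP.
have c1c t : `|t| < d -> {for t, continuous (fst \o c)}.
  by move=> td; apply: continuous_comp; [exact: cc|exact: fst_continuous].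
have dom t : `|t| < d -> mdom i (tpt (gamma t)).
  by move=> td; rewrite pt//; apply: mpsi_dom; have [[]] := cP t td.
exists gamma; split.
- move=> t /in_d td; have [[ht ct0] dc] := cP t td; split.
  + exists i; have [h ->] := gammaE t td.
    by have /= -> := congr1 snd (tvecK h).
  + have : (mpsi i \o (fst \o c)) s @[s --> t] --> (mpsi i \o (fst \o c)) t.
      apply: continuous_comp; first exact: c1c.
      exact: mpsi_continuous.
    rewrite /prop_for /continuous_at /= pt//; apply: cvg_trans.
    apply: near_eq_cvg; apply: filterS (near_d t td) => s sd.
    by rewrite /= pt.
  (* In another chart the curve reads [ttrans i j \o c], and the chain rule meets the transformation
     law of [S]. *)
  + move=> j jt; rewrite pt// in jt.
    have ijt : overlap i j (c t).1 by [].
    have tE s : `|s| < d -> mdom j (mpsi i (c s).1) ->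
        tcoord j (gamma s) = ttrans i j (c s).
      move=> sd js; have [h ->] := gammaE s sd.
      by rewrite /tcoord /ttrans /= /tvec_comp (asboolT js).
    rewrite tE// (svf_trans S (conj ht ct0) jt).
    apply: (@near_eq_is_derive _ _ _ (ttrans i j \o c)).
      have : \forall s \near t, overlap i j (c s).1.
        apply: (c1c t td); apply: open_nbhs_nbhs; split=> //; exact: overlap_open.
      by apply: filterS2 (near_d t td) => s sd [_ js]; rewrite /= tE.
    by apply: is_derive_curve_comp => //; exact: ttrans_differentiable.
- have o_d : `|0 : R| < d by rewrite normr0.
  by have [h ->] := gammaE 0 o_d; rewrite tvecK.
- by move=> t /in_d; exact: dom.
Qed.

End Charts.

(** * Comparison of sprays along reparametrised geodesics *)

Section Reparametrisation.
Context {R : realType} {n : nat} {M : smooth_manifold R n}.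
Local Notation E := ('rV[R]_n * 'rV[R]_n)%type.

(* Differentiate the equality of the base points twice. *)
Lemma second_order_reparametrisation (xi zeta : R -> E) (tau : R -> R) (t0 : R)
    (X Y : E -> E) :
  (\forall t \near t0, is_derive (t : R) 1 xi (X (xi t)) /\ (X (xi t)).1 = (xi t).2) ->
  (\forall t \near t0, is_derive (tau t) 1 zeta (Y (zeta (tau t))) /\
     (Y (zeta (tau t))).1 = (zeta (tau t)).2) ->
  (\forall t \near t0, derivable tau (t : R) 1) -> derivable ('D_1 tau) t0 1 ->
  (\forall t \near t0, (xi t).1 = (zeta (tau t)).1) ->
  let l := 'D_1 tau t0 in
  xi t0 = ((zeta (tau t0)).1, l *: (zeta (tau t0)).2) /\
  X (xi t0) = (l *: (zeta (tau t0)).2,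
    l ^+ 2 *: (Y (zeta (tau t0))).2 + 'D_1 ('D_1 tau) t0 *: (zeta (tau t0)).2).
Proof.
move=> dxi dzeta dtau ddtau base l.
have dzt (t : R) : derivable tau t 1 -> is_derive (tau t) 1 zeta (Y (zeta (tau t))) ->
    is_derive t 1 (zeta \o tau) ('D_1 tau t *: Y (zeta (tau t))).
  move=> dt dz; have dzd : differentiable zeta (tau t).
    by apply/derivable1_diffP; case: dz.
  have := is_derive_curve_comp (derivableP dt) dzd.
  have -> // : 'D_('D_1 tau t) zeta (tau t) = 'D_1 tau t *: Y (zeta (tau t)).
  have E1 := deriveZdir dzd ('D_1 tau t) 1; have E2 := @derive_val _ _ _ _ _ _ _ dz.
  rewrite -E2 -E1; congr ('D__ zeta _); exact: esym (mulr1 _).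
(* The first differentiation is carried out on a whole neighbourhood of [t0], so that its result can
   be differentiated again. *)
have fibre : \forall t \near t0, (xi t).2 = 'D_1 tau t *: (zeta (tau t)).2.
  have base2 : \forall t \near t0, \forall s \near t, (xi s).1 = (zeta (tau s)).1.
    exact: near_join base.
  apply: filterS2 (filterI dxi dzeta) (filterI dtau base2).
  move=> t [[dx xE] [dz zE]] [dt bt].
  have D1 := is_derive_linear_comp fst_linear (@fst_continuous R n) dx.
  have D2 := is_derive_linear_comp fst_linear (@fst_continuous R n) (dzt t dt dz).
  have E1 := @near_eq_derive _ _ _ (fst \o xi) (fst \o (zeta \o tau)) t 1 bt.
  apply: etrans (esym xE) _; apply: etrans (esym (@derive_val _ _ _ _ _ _ _ D1)) _.
  by apply: etrans E1 _; apply: etrans (@derive_val _ _ _ _ _ _ _ D2) _; rewrite /= zE.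
have [dx xE] := nbhs_singleton dxi; have [dz zE] := nbhs_singleton dzeta.
have fib0 := nbhs_singleton fibre; have bas0 := nbhs_singleton base.
split; first by rewrite [LHS]surjective_pairing bas0 fib0.
rewrite [LHS]surjective_pairing xE fib0; congr pair; apply/rowP => k.
have dt := nbhs_singleton dtau.
have D1 := is_derive_linear_comp (snd_coord_linear k) (@snd_coord_continuous R n k) dx.
have D2 := is_derive_linear_comp (snd_coord_linear k) (@snd_coord_continuous R n k)
  (dzt t0 dt dz).
have D3 := is_deriveM (derivableP ddtau) D2.
have fibk : \forall t \near t0, ((fun z : E => z.2 0 k) \o xi) t =
    ('D_1 tau * ((fun z : E => z.2 0 k) \o (zeta \o tau))) t.
  by apply: filterS fibre => t /= ->; rewrite mxE.
apply: etrans (esym (@derive_val _ _ _ _ _ _ _ D1)) _.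
apply: etrans (@near_eq_derive _ _ _ _ _ t0 1 fibk) _.
apply: etrans (@derive_val _ _ _ _ _ _ _ D3) _.
rewrite /= !mxE /l; move: ('D_1 tau t0) ('D_1 ('D_1 tau) t0) => a b.
by rewrite /GRing.scale /= expr2 mulrA; congr (_ + _); exact: mulrC.
Qed.

(** Here [l] and [c] are the first and second derivatives of the parameter change [tau] at a time
    [t0] with [tau t0 = 0]; such a time exists because [tau] maps onto the interval of the
    F-geodesic. *)
Lemma projective_transfer (F Ft : tangent_bundle M -> R)
    (S : slit_vector_field M) (i : mindex M) (z : E) :
  geodesic_spray F S -> projectively_related F Ft -> slit_range i z ->
  exists (St : slit_vector_field M) (l c : R), [/\ geodesic_spray Ft St, 0 < l &
    St i (z.1, l *: z.2) = (l *: z.2, l ^+ 2 *: (S i z).2 + c *: z.2)].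
Proof.
move=> hS [proj _] iz.
have [d d0 [gamma [icg g0 dg]]] := integral_curve_exists S iz.
have o_d : (0 : R) \in `]-d, d[ by rewrite in_itv /= oppr_lt0 d0.
have geo : geodesic F `]-d, d[ (fun t => tpt (gamma t)).
  split; [exact: interval_open|exact: interval_is_interval|by exists 0|].
  by exists S, gamma.
have [J' [c' [[oJ' _ _ [St [gamt [hSt ict c'E]]]] [tau [stau tau_gt0 tauJ tauE]]]]] :=
  proj _ _ geo.
have [t0 J't0 tau0] : (tau @` J') 0 by rewrite tauJ.
have J't : \forall t \near t0, J' t by exact: open_nbhs_nbhs.
have tauJ' t : J' t -> tau t \in `]-d, d[.
  move=> J't'; have : (tau @` J') (tau t) by exists t.
  by rewrite tauJ.
have base t : J' t -> tpt (gamt t) = tpt (gamma (tau t)).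
  by move=> J't'; rewrite -c'E// tauE.
have domt t : J' t -> mdom i (tpt (gamt t)).
  by move=> J't'; rewrite base//; apply: dg; exact: tauJ'.
have sprayE (G : tangent_bundle M -> R) (X : slit_vector_field M)
    (v : tangent_bundle M) : geodesic_spray G X -> slit_tangent_bundle v ->
    mdom i (tpt v) -> (X i (tcoord i v)).1 = (tcoord i v).2.
  by move=> hX sv iv; have [] := hX i _ (tcoord_slit_range sv iv).
have [] := @second_order_reparametrisation (tcoord i \o gamt) (tcoord i \o gamma)
  tau t0 (St i) (S i).
- apply: filterS J't => t Jt; have [sv _ D] := ict t Jt.
  by split; [exact/D/domt|apply: sprayE hSt sv _; exact: domt].
- apply: filterS J't => t Jt; have [sv _ D] := icg _ (tauJ' _ Jt).
  by split; [exact/D/dg/tauJ'|apply: sprayE hS sv _; exact/dg/tauJ'].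
- by apply: filterS J't => t Jt; exact: smooth_on_derivable stau Jt.
- exact: (smooth_on_derivable (smooth_on_derive (1 : R) stau) J't0).
- by apply: filterS J't => t Jt; rewrite /tcoord /= base.
have gz : (tcoord i \o gamma) 0 = z := g0.
rewrite tau0 gz => E1 E2.
exists St, ('D_1 tau t0), ('D_1 ('D_1 tau) t0); split => //.
  exact: tau_gt0.
by rewrite -E1; exact: E2.
Qed.

End Reparametrisation.

(** * Finsler metrics *)

Section FinslerChart.
Context {R : realType} {n : nat} {M : smooth_manifold R n}.
Local Notation E := ('rV[R]_n * 'rV[R]_n)%type.
Implicit Types (F : tangent_bundle M -> R) (i : mindex M) (z : E).

Lemma pd_at_minimum (U : set E) (f : E -> R) z v : open U -> smooth_on U f ->
  U z -> (forall x, f z <= f x) -> pd v f z = 0.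
Proof.
move=> oU sf Uz fmin; have lineU : \forall t \near (0 : R), U (z + t *: v).
  have cl : {for (0 : R), continuous (fun t : R => z + t *: v)}.
    by apply: continuousD; [exact: cst_continuous|exact: scalel_continuous].
  apply: cl; rewrite /= scale0r addr0; exact: open_nbhs_nbhs.
have /nbhs_ballP[r /= r0 rP] := lineU.
have rU (t : R) : t \in `]-r, r[ -> U (z + t *: v).
  rewrite in_itv /= -ltr_norml => tr; apply: rP.
  by rewrite -ball_normE /= sub0r normrN.
have dl (t : R) : t \in `]-r, r[ ->
    is_derive t 1 (fun t => f (z + t *: v)) (pd v f (z + t *: v)).
  move=> /rU Ut; apply: is_derive_line; apply: derivableP.
  exact: smooth_on_derivable Ut.
have o_r : (0 : R) \in `]-r, r[ by rewrite in_itv /= oppr_lt0 r0.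
have rr : - r <= r by rewrite (@le_trans _ _ 0)// ?oppr_le0 ltW.
have D := @derive1_at_min _ (fun t => f (z + t *: v)) (- r) r 0 rr
  (fun t tr => @ex_derive _ _ _ _ _ _ _ (dl t tr)) o_r.
have {}D : is_derive (0 : R) 1 (fun t => f (z + t *: v)) 0.
  by apply: D => t _; rewrite scale0r addr0.
have := @derive_val _ _ _ _ _ _ _ (dl 0 o_r); rewrite scale0r addr0 => <-.
exact: (@derive_val _ _ _ _ _ _ _ D).
Qed.

Lemma local_expr_ge0 F i z : (forall v, 0 <= F v) -> 0 <= local_expr F i z.
Proof. by move=> F0; rewrite /local_expr; case: pselect. Qed.

Section Metric.
Variables (F : tangent_bundle M -> R) (i : mindex M).
Hypothesis hF : finsler_metric F.
Local Notation f := (local_expr F i).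
Local Notation U := (slit_range i).
Let oU : open U := @slit_range_open R n M i.
Let sf : smooth_on U f := finsler_smooth hF i.
Let sff : smooth_on U (fun x => f x * f x) := smooth_onM oU sf sf.

Let sqFE : sqF F i = fun x => f x * f x.
Proof. by apply/funext => x; rewrite /sqF expr2. Qed.

Let hom_f : ray_homogeneous U f.
Proof. by move=> z l Uz l0; exact: (finsler_homogeneous hF). Qed.

Lemma metric_tensorE z : metric_tensor F i z = 2^-1 *: yhessian (fun x => f x * f x) z.
Proof. by apply/matrixP => k l; rewrite /metric_tensor sqFE mxE [RHS]mxE mxE. Qed.

Lemma angular_metricE z : angular_metric F i z = f z *: yhessian f z.
Proof. by apply/matrixP => k l; rewrite mxE [RHS]mxE mxE. Qed.

(* A zero of [F] is a minimum, hence a critical point, of [F]; there the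
   Hessian of [F^2] would vanish. *)
Lemma finsler_neq0 z : (0 < n)%N -> U z -> f z != 0.
Proof.
move=> n0 Uz; apply/eqP => fz0.
have crit v : pd v f z = 0.
  apply: pd_at_minimum oU sf Uz _ => x; rewrite fz0.
  exact/local_expr_ge0/(finsler_ge0 hF).
have g0 : metric_tensor F i z = 0.
  rewrite metric_tensorE; apply/matrixP => k l; rewrite !mxE.
  have D2 x : U x -> pd (ydir R l) (fun x => f x * f x) x = 2 * (f x * pd (ydir R l) f x).
    by move=> Ux; rewrite (pdM _ sf sf Ux) mulr2n mulrDl mul1r.
  have sl := smooth_on_pd (ydir R l) sf.
  rewrite (pd_eq_on oU _ D2 Uz) (pdZ _ _ (smooth_onM oU sf sl) Uz) (pdM _ sf sl Uz).
  by rewrite fz0 (crit (ydir R k)) mul0r mulr0 addr0 !mulr0.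
have := mulVmx (finsler_nondegenerate hF Uz); rewrite g0 mulmx0.
move=> /matrixP/(_ (Ordinal n0) (Ordinal n0)); rewrite !mxE eqxx => /eqP.
by rewrite eq_sym oner_eq0.
Qed.

Let euler_square x : U x ->
  pd (liouville x) (fun x => f x * f x) x = 2 * (f x * f x).
Proof.
move=> Ux; rewrite (pdM _ sf sf Ux) (euler_identity sf hom_f Ux).
by rewrite mulr2n mulrDl mul1r.
Qed.

Lemma spray_euler_lagrange (S : slit_vector_field M) z : (0 < n)%N ->
  geodesic_spray F S -> U z ->
  [/\ euler_lagrange (S i z) (fun x => f x * f x) z, pd (S i z) f z = 0 &
      euler_lagrange (S i z) f z].
Proof.
move=> n0 hS Uz; have [S1 ELk] := hS i z Uz.
have EL : euler_lagrange (S i z) (fun x => f x * f x) z.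
  apply: (euler_lagrange_basis oU sff Uz) => k.
  by have := ELk k; rewrite sqFE.
have E0 := energy_conserved oU sff Uz S1 EL euler_square.
by have [] := euler_lagrange_sqrt oU sf Uz (finsler_neq0 n0 Uz) EL E0.
Qed.

End Metric.

Lemma projective_euler_lagrange F Ft (S : slit_vector_field M) i z : (0 < n)%N ->
  finsler_metric Ft -> projectively_related F Ft -> geodesic_spray F S ->
  slit_range i z -> euler_lagrange (S i z) (local_expr Ft i) z.
Proof.
move=> n0 hFt proj hS Uz.
have [St [l [c [hSt l0 StE]]]] := projective_transfer hS proj Uz.
have Ulz := slit_range_conic Uz l0.
have S1 : (S i z).1 = z.2 by have [] := hS i z Uz.
have [_ _ EL] := spray_euler_lagrange hFt n0 hSt Ulz.
rewrite StE -[X in (l *: X, _)]S1 in EL.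
have hom : ray_homogeneous (slit_range i) (local_expr Ft i).
  by move=> x t Ux t0; exact: (finsler_homogeneous hFt).
exact: (ray_homogeneous_euler_lagrange (@slit_range_open R n M i)
  (@slit_range_conic R n M i) (finsler_smooth hFt i) hom Uz l0 S1 EL).
Qed.

End FinslerChart.

Theorem theorem1p1 (R : realType) (n : nat) (hn : (2 <= n)%N)
  (M : smooth_manifold R n) (F Ft : tangent_bundle M -> R)
  (hF : finsler_metric F) (hFt : finsler_metric Ft)
  (hproj : projectively_related F Ft)
  (S : slit_vector_field M) (hS : geodesic_spray F S)
  (alpha : nat) (halpha : (1 <= alpha <= n.-1)%N) :
  first_integral S (calf F Ft alpha).
Proof.
move=> i z Uz; have n0 : (0 < n)%N by exact: ltnW.
pose U := slit_range i; have oU : open U := @slit_range_open R n M i.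
pose f := local_expr F i; pose ft := local_expr Ft i.
have sf : smooth_on U f := finsler_smooth hF i.
have sft : smooth_on U ft := finsler_smooth hFt i.
have sff : smooth_on U (fun x => f x * f x) := smooth_onM oU sf sf.
have S1 x : U x -> (S i x).1 = x.2 by move=> Ux; have [] := hS i x Ux.
have Sd x : U x -> differentiable (S i) x by exact: smooth_on_diff (@svf_smooth _ _ _ S i).
have [_ Sf0 _] := spray_euler_lagrange hF n0 hS Uz.
have ELff x : U x -> euler_lagrange (S i x) (fun x => f x * f x) x.
  by move=> Ux; have [] := spray_euler_lagrange hF n0 hS Ux.
have ELft x : U x -> euler_lagrange (S i x) ft x.
  by move=> Ux; exact: projective_euler_lagrange hFt hproj hS Ux.
have nearU : \forall x \near z, U x by exact: open_nbhs_nbhs.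
have pdP (g : _ -> R) : smooth_on U g -> is_derive z (S i z) g (pd (S i z) g z).
  by move=> sg; apply: derivableP; exact: smooth_on_derivable Uz.
pose N := spray_connection (S i) z.
have hess (g : _ -> R) k l : smooth_on U g ->
    (forall x, U x -> euler_lagrange (S i x) g x) ->
    is_derive z (S i z) (fun x => yhessian g x k l)
      ((N^T *m yhessian g z + yhessian g z *m N) k l).
  move=> sg EL; rewrite -(pd_yhessian oU S1 Sd k l sg EL Uz).
  apply: pdP; have -> : (fun x => yhessian g x k l) = pd (ydir R k) (pd (ydir R l) g).
    by apply/funext => x; rewrite mxE.
  by apply: smooth_on_pd; exact: smooth_on_pd.
(* The denominator of the factor [F / Ft] in [calH] cancels the factor [Ft] of the angular metric.
   This requires [Ft] to be nonzero near [z]. *)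
apply: (@near_eq_is_derive _ _ _ (fun x => (\det (map_mx polyC
    (invmx (metric_tensor F i x) *m (f x *: yhessian ft x)) + 'X%:M))`_alpha)).
  apply: filterS nearU => x Ux; rewrite /calf /calQ /calH angular_metricE.
  have ft0 : local_expr Ft i x != 0 by exact: (finsler_neq0 hFt n0 Ux).
  by rewrite -!scalemxAr scalerA divfK.
apply: (@is_derive_pencil_charpoly _ _ _ _ _ _ _ N) => [k l|k l|].
- have -> : (fun x => metric_tensor F i x k l) =
      2^-1 *: (fun x => yhessian (fun x => f x * f x) x k l).
    by apply/funext => x; rewrite metric_tensorE mxE.
  rewrite metric_tensorE -scalemxAr -scalemxAl -scalerDr mxE.
  by apply: is_deriveZ; exact: hess.
- have -> : (fun x => (f x *: yhessian ft x) k l) = f * (fun x => yhessian ft x k l).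
    by apply/funext => x; rewrite mxE.
  rewrite -scalemxAr -scalemxAl -scalerDr mxE.
  apply: is_derive_eq (is_deriveM (pdP f sf) (hess ft k l sft ELft)) _.
  by rewrite Sf0 scaler0 addr0.
- by apply: filterS nearU => x Ux; exact: finsler_nondegenerate hF _ _ Ux.
Qed.
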